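(* Let $N\ge1$, $r>0$, $\gamma>1$, and let $r_k=r\gamma^{N+1-k}$, $k=1,\dots,N+1$. For any fixed core conductivity $\sigma_{N+1}\ge0$ there exists a combination $(\sigma_1,\dots,\sigma_N)$ of coating conductivities such that the $N$-GPTs of the two-dimensional concentric disk structure with radii $r_1,\dots,r_{N+1}$ vanish, i.e. $M_n=0$ for $n=1,\dots,N$. Furthermore, if $\sigma_{N+1}=0$, this combination is unique.
   Context: Dimension $d=2$. Let $\Gamma_k=\{x\in\mathbb{R}^2:|x|=r_k\}$ with outward unit normal $\nu_k$, $k=1,\dots,N+1$. The regions $\Omega_0=\{|x|>r_1\}$ (background), $\Omega_k=\{r_{k+1}<|x|\le r_k\}$ ($1\le k\le N$, coatings), $\Omega_{N+1}=\{|x|\le r_{N+1}\}$ (core) have constant conductivities $\sigma_k\geq 0$, with $\sigma_0=1$ and $\sigma_{k-1}+\sigma_k\ne0$ for $k=1,\dots,N+1$; put $\eta_k=\frac{\sigma_k-\sigma_{k-1}}{\sigma_k+\sigma_{k-1}}\in[-1,1]$. Let $G(x)=\frac{1}{2\pi}\ln|x|$, $\mathcal{S}_{\Gamma}[\phi](x)=\int_\Gamma G(x-y)\phi(y)\,d\sigma_y$, $\mathcal{K}^*_\Gamma[\phi](x)=\int_\Gamma \frac{\partial G(x-y)}{\partial\nu_x}\phi(y)\,d\sigma_y$ for $x\in\Gamma$, and $L_0^2(\Gamma)=\{\phi\in L^2(\Gamma):\int_\Gamma\phi=0\}$. For $n\ge1$, let $(\phi_1,\dots,\phi_{N+1})\in\prod_k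 L^2_0(\Gamma_k)$ be the solution of $$\phi_j-2\eta_j\mathcal{K}^*_{\Gamma_j}[\phi_j]-2\eta_j\sum_{k\ne j}\partial_{\nu_j}\mathcal{S}_{\Gamma_k}[\phi_k]=2\eta_j\,\partial_{\nu_j}H\quad\text{on }\Gamma_j,\qquad j=1,\dots,N+1,$$ with $H(x)=r^n\cos n\theta$ in polar coordinates $(r,\theta)$ (here $r=|x|$). Set $M_n=M_n[\eta]=\sum_{k=1}^{N+1}\int_{\Gamma_k} |x|^n\cos(n\theta)\,\phi_k\,d\sigma$. *)

(* Defs.v *)
From HB Require Import structures.
From mathcomp Require Import all_boot all_order all_algebra.
From mathcomp Require Import all_classical all_reals all_analysis.

Set Implicit Arguments.
Unset Strict Implicit.
Unset Printing Implicit Defensive.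

Import Order.TTheory GRing.Theory Num.Theory.
Import numFieldNormedType.Exports.

Local Open Scope classical_set_scope.
Local Open Scope ring_scope.

Section Plane.
Context {R : realType}.
Implicit Types (x y : R * R) (r t : R) (n : nat).

(* The library norm of R * R is the sup norm. *)
Definition enorm x : R := Num.sqrt (x.1 ^+ 2 + x.2 ^+ 2).

(* Argument in ]-pi, pi]; its value at the origin is irrelevant. *)
Definition arg x : R :=
  let a := acos (x.1 / enorm x) in if 0 <= x.2 then a else - a.

(* r^n cos(n theta) in polar coordinates *)
Definition polar_harmonic n x : R := enorm x ^+ n * cos (n%:R * arg x).

(* Fundamental solution of the Laplacian; ln 0 = 0 in the library. *)
Definition G x : R := ln (enorm x) / (2 * pi).

Definition circle r t : R * R := (r * cos t, r * sin t).

(* Outward unit normal at x to the circle centred at 0 through x *)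
Definition normal x : R * R := (enorm x)^-1 *: x.

Definition normal_derivative (f : R * R -> R) x : R := 'D_(normal x) f x.

Definition circle_integral r (f : R * R -> R) : R :=
  \int[lebesgue_measure]_(t in `[0, 2 * pi]) (f (circle r t) * r).

Definition circle_ae r (P : R * R -> Prop) : Prop :=
  {ae (@lebesgue_measure R),
    forall t, t \in `[0, 2 * pi]%R -> P (circle r t)}.

(* Functions on a circle are represented by functions on the plane, of which
   only the restriction to that circle is ever used. *)
Definition L20 r (phi : R * R -> R) : Prop :=
  [/\ measurable_fun `[0, 2 * pi]%classic (phi \o circle r),
      (@lebesgue_measure R).-integrable `[0, 2 * pi]
        (fun t => (phi (circle r t) ^+ 2)%:E) &
      circle_integral r phi = 0].

Definition single_layer r (phi : R * R -> R) x : R :=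
  circle_integral r (fun y => G (x - y) * phi y).

Definition Kstar r (phi : R * R -> R) x : R :=
  circle_integral r (fun y => normal_derivative (fun z => G (z - y)) x * phi y).

End Plane.

Section Multilayer.
Context {R : realType}.

(* (sigma_0, ..., sigma_(N+1)) = (1, s_1, ..., s_N, core) *)
Definition conductivity (N : nat) (s : N.-tuple R) (core : R) (k : nat) : R :=
  nth 0 (1 :: rcons s core) k.

Definition admissible (N : nat) (sigma : nat -> R) : Prop :=
  (forall k, (k <= N.+1)%N -> 0 <= sigma k) /\
  (forall k, (1 <= k <= N.+1)%N -> sigma k.-1 + sigma k != 0).

Definition contrast (sigma : nat -> R) (k : nat) : R :=
  (sigma k - sigma k.-1) / (sigma k + sigma k.-1).

(* The interfaces are numbered 1, ..., N.+1, interface k having radius rad k;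
   the values of rad, eta and phi at other indices are not used. *)
Definition is_density (N : nat) (rad eta : nat -> R) (n : nat)
    (phi : nat -> R * R -> R) : Prop :=
  (forall j, (1 <= j <= N.+1)%N -> L20 (rad j) (phi j)) /\
  (forall j, (1 <= j <= N.+1)%N ->
    circle_ae (rad j) (fun x =>
      phi j x - 2 * eta j * Kstar (rad j) (phi j) x
      - 2 * eta j * (\sum_(1 <= k < N.+2 | k != j)
          normal_derivative (single_layer (rad k) (phi k)) x)
      = 2 * eta j * normal_derivative (polar_harmonic n) x)).

Definition moment (N : nat) (rad : nat -> R) (n : nat)
    (phi : nat -> R * R -> R) : R :=
  \sum_(1 <= k < N.+2)
    circle_integral (rad k) (fun x => polar_harmonic n x * phi k x).

(* M_n = m: the densities exist, and the moment of any choice of them (they are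
   determined only almost everywhere) is m. *)
Definition is_GPT (N : nat) (rad eta : nat -> R) (n : nat) (m : R) : Prop :=
  (exists phi, is_density N rad eta n phi) /\
  (forall phi, is_density N rad eta n phi -> moment N rad n phi = m).

Definition layer_radius (N : nat) (r gamma : R) (k : nat) : R :=
  r * gamma ^+ (N.+1 - k)%N.

Definition GPT_vanishing_coating (N : nat) (r gamma core : R)
    (s : N.-tuple R) : Prop :=
  let sigma := conductivity s core in
  admissible N sigma /\
  (forall n, (1 <= n <= N)%N ->
    is_GPT N (layer_radius N r gamma) (contrast sigma) n 0).

End Multilayer.

(* Main.v *)
(** In the n-th Fourier mode the integral equations become a linear system for
    the numbers b_k = r_k^(n+1) * (n-th cosine coefficient of phi_k), and M_n is
    the sum of the b_k.  Solving the system layer by layer from the core gives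
    Q(w) M_n = 2 pi n r_1^(2n) P(w) with w = (r_(k+1)/r_k)^(2n) = gamma^(-2n),
    where P/Q is produced by the Schur recursion
    (P, Q) <- (eta_k Q + w P, Q + eta_k w P).
    For geometric radii P and Q do not depend on n, so M_1 = ... = M_N = 0 means
    that the polynomial P, of degree at most N, vanishes at q, q^2, ..., q^N with
    q = gamma^(-2).  Hence P is a multiple of P0 = prod (X - q^n).

    At w = 1 the recursion telescopes and (1 + P/Q)/(1 - P/Q) is the core
    conductivity, which fixes t = P(1)/Q(1) = (core - 1)/(core + 1).  Normalizing
    Q(1) = 1, the Schur parameters exist as soon as P/Q is a Schur function and
    Q Q* = P P* + (1 - t^2) X^N (with * the reversal), and such a Q is given by
    the Fejer-Riesz factorization, or by a Blaschke product when core = 0.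
    When core = 0 the last parameter is -1, so P = - P0 and Q = - P*, and P/Q
    determines its Schur parameters. *)

Require Import Defs.
From HB Require Import structures.
From mathcomp Require Import all_boot all_order all_algebra.
From mathcomp Require Import all_classical all_reals all_analysis.
From mathcomp Require Import measurable_realfun complex.
From mathcomp Require Import ring lra zify.

Set Implicit Arguments.
Unset Strict Implicit.
Unset Printing Implicit Defensive.

Import Order.TTheory GRing.Theory Num.Theory.
Import numFieldNormedType.Exports ComplexField.Normc.

Local Open Scope classical_set_scope.
Local Open Scope ring_scope.

(** * Reversed polynomials *)

Section Reversal.
Context {F : fieldType}.
Implicit Types (p q : {poly F}) (a b d : nat).

(** The condition on [Q Q*] is forced: one step of the recursion multiplies [Q Q* - P P*] by
    [(1 - eta_k^2) X], so this difference is a constant times [X^N], and the values at 1 give the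
    constant [1 - t^2]. Conversely [P] is fixed by its zeros and [P(1) = t], so the condition is a
    spectral factorization problem for [Q]. Among its solutions the one without zeros in the closed
    unit disk is taken, since only this one makes [P/Q] bounded by 1 there.

    The obstacle is that bound, usually a matter of the maximum principle. It is replaced by an l^2
    inequality between truncated coefficient sequences, which survives each step of the Schur
    algorithm by finite identities. The identity for [Q Q*] yields the inequality for full sequences
    only; an approximate polynomial inverse of [Q], available because its zeros lie outside the
    disk, brings it down to truncations.

    The case [core = 1] stands apart: there [t = 0] and [P = 0], and a coating without any contrast
    does it. *)

Definition revp d p : {poly F} := \sum_(i < d.+1) p`_i *: 'X^(d - i).

Lemma poly_sumE d p : (size p <= d.+1)%N ->
  p = \sum_(i < d.+1) p`_i *: 'X^i.
Proof.
move=> sp; rewrite -[LHS]coefK poly_def (big_ord_widen _ (fun i =>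
  p`_i *: 'X^i) sp) big_mkcond/=.
by apply: eq_bigr => i _; case: ltnP => // ?; rewrite nth_default// scale0r.
Qed.

Lemma coef_revp d p i : (revp d p)`_i = if (i <= d)%N then p`_(d - i) else 0.
Proof.
rewrite /revp coef_sum; case: leqP => id.
  have h : (d - i < d.+1)%N by lia.
  rewrite (bigD1 (Ordinal h))//= coefZ coefXn subKn// eqxx mulr1 big1 ?addr0//.
  move=> j /eqP/val_eqP/= ji; rewrite coefZ coefXn.
  by case: eqP; rewrite ?mulr0// => ?; move: ji (ltn_ord j); lia.
by rewrite big1// => j _; rewrite coefZ coefXn; case: eqP; rewrite ?mulr0//; lia.
Qed.

Lemma size_revp d p : (size (revp d p) <= d.+1)%N.
Proof. by apply/leq_sizeP => j dj; rewrite coef_revp leqNgt dj. Qed.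

Lemma revpD d p q : revp d (p + q) = revp d p + revp d q.
Proof. by apply/polyP => i; rewrite coefD !coef_revp coefD; case: ifP; rewrite ?addr0. Qed.

Lemma revpZ d c p : revp d (c *: p) = c *: revp d p.
Proof. by apply/polyP => i; rewrite coefZ !coef_revp coefZ; case: ifP; rewrite ?mulr0. Qed.

Lemma revpN d p : revp d (- p) = - revp d p.
Proof. by rewrite -scaleN1r revpZ scaleN1r. Qed.

Lemma revp_sum d I (s : seq I) (P : pred I) (f : I -> {poly F}) :
  revp d (\sum_(i <- s | P i) f i) = \sum_(i <- s | P i) revp d (f i).
Proof.
elim/big_rec2: _ => [|i p q _ <-]; last by rewrite revpD.
by apply/polyP => i; rewrite coef_revp !coef0 if_same.
Qed.

Lemma revpXn d k : (k <= d)%N -> revp d 'X^k = 'X^(d - k).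
Proof.
move=> kd; apply/polyP => i; rewrite coef_revp !coefXn.
case: leqP => id; first by have -> : (d - i == k)%N = (i == d - k)%N by lia.
by have -> : (i == d - k)%N = false by lia.
Qed.

Lemma revpM a b p q : (size p <= a.+1)%N -> (size q <= b.+1)%N ->
  revp (a + b) (p * q) = revp a p * revp b q.
Proof.
move=> sp sq; rewrite {1}(poly_sumE sp) {1}(poly_sumE sq) !big_distrlr/= revp_sum.
apply: eq_bigr => i _; rewrite revp_sum; apply: eq_bigr => j _.
rewrite -!scalerAl -!scalerAr -!exprD !revpZ revpXn; last by have := ltn_ord i;
  have := ltn_ord j; lia.
by congr (_ *: (_ *: 'X^_)); have := ltn_ord i; have := ltn_ord j; lia.
Qed.

Lemma revpK d p : (size p <= d.+1)%N -> revp d (revp d p) = p.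
Proof.
move=> sp; apply/polyP => i; rewrite !coef_revp leq_subr.
by case: leqP => id; [rewrite subKn | rewrite nth_default// (leq_trans sp)].
Qed.

Lemma horner_revp d p z : (size p <= d.+1)%N -> z != 0 ->
  (revp d p).[z] = z ^+ d * p.[z^-1].
Proof.
move=> sp z0; rewrite {2}(poly_sumE sp) /revp !horner_sum mulr_sumr.
apply: eq_bigr => i _; rewrite !hornerZ !hornerXn exprVn.
have le_id : (i <= d)%N by rewrite -ltnS.
have -> : z ^+ d = z ^+ (d - i) * z ^+ i by rewrite -exprD subnK.
by rewrite mulrCA mulfK// expf_neq0.
Qed.

Lemma horner_revp1 d p : (size p <= d.+1)%N -> (revp d p).[1] = p.[1].
Proof. by move=> sp; rewrite horner_revp ?oner_neq0// expr1n mul1r invr1. Qed.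

Lemma revpMX d p : (size p <= d.+1)%N -> revp d.+1 ('X * p) = revp d p.
Proof. by move=> sp; rewrite -[d.+1]add1n (@revpM 1 d)// ?size_polyX// -['X]expr1
  revpXn// subnn mul1r. Qed.

Lemma revp_widen d p : (size p <= d.+1)%N -> revp d.+1 p = 'X * revp d p.
Proof.
by move=> sp; rewrite -[d.+1]add1n -{1}[p]mul1r (@revpM 1 d)// ?size_poly1// -['X]/('X^(1
  - 0)%N) -revpXn.
Qed.

Lemma revp_prod_XsubC (s : seq F) :
  revp (size s) (\prod_(a <- s) ('X - a%:P)) = \prod_(a <- s) (1 - a *: 'X).
Proof.
elim: s => [|a s IH]; first by rewrite !big_nil; exact: (@revpXn 0 0).
rewrite !big_cons -[size _]/(1 + size s)%N revpM ?size_prod_XsubC ?size_XsubC// IH.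
congr (_ * _); apply/polyP => -[|[|i]];
  rewrite coef_revp//= !(coefB, coefX, coefC, coefZ, coef1)/=; ring.
Qed.

End Reversal.

(** * Schur recursion *)

Section SchurRecursion.
Context {R : realFieldType}.
Implicit Types (P Q x : {poly R}) (s t : seq R) (e w : R).

(** The head of the list is the outermost contrast; [(0, 1)] stands for the homogeneous core, which
    contains no further interface. *)
Fixpoint schur s : {poly R} * {poly R} :=
  if s is e :: s' then
    let: (P, Q) := schur s' in (e *: Q + 'X * P, Q + e *: ('X * P))
  else (0, 1).

Definition snum s := (schur s).1.
Definition sden s := (schur s).2.

Lemma snum_cons e s : snum (e :: s) = e *: sden s + 'X * snum s.
Proof. by rewrite /snum /sden /=; case: (schur s). Qed.

Lemma sden_cons e s : sden (e :: s) = sden s + e *: ('X * snum s).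
Proof. by rewrite /snum /sden /=; case: (schur s). Qed.

(** A step turns [Q + P] and [Q - P] into [1 + e] times [Q + w P] and [1 - e] times [Q - w P], all
    nonnegative. Strict positivity comes from [w < 1]; it allows division by the denominator even
    when a contrast has modulus 1. *)
Lemma schur_bound s w : {in s, forall e, `|e| <= 1} -> 0 < w < 1 ->
  0 < (sden s).[w] /\ `|(snum s).[w]| <= (sden s).[w].
Proof.
move=> s1 /andP[w0 w1]; elim: s s1 => [|e s IH] s1.
  by rewrite /snum /sden /= !hornerE normr0; split.
have [|Q0 PQ] := IH; first by move=> a sa; apply: s1; rewrite inE sa orbT.
have e1 : `|e| <= 1 by apply: s1; rewrite inE eqxx.
rewrite snum_cons sden_cons !(hornerD, hornerZ, hornerM, hornerX).
set p := (snum s).[w] in PQ *; set q := (sden s).[w] in Q0 PQ *.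
move: e1 PQ; rewrite !ler_norml => /andP[e1 e2] /andP[pq1 pq2].
have h : `|e * (w * p)| < q.
  rewrite !normrM (gtr0_norm w0) mulrA (@le_lt_trans _ _ (w * q))//.
    by apply: ler_pM => //; rewrite ?mulr_ge0// ?(ltW w0)// ?ler_norml ?pq1//
      ler_piMl ?ler_norml ?e1// ltW.
  by rewrite gtr_pMl.
move: h; rewrite ltr_norml => /andP[h1 h2].
have wp1 : - q <= w * p by nra.
have wp2 : w * p <= q by nra.
have a1 : 0 <= (1 - e) * (q - w * p) by apply: mulr_ge0; lra.
have a2 : 0 <= (1 + e) * (q + w * p) by apply: mulr_ge0; lra.
by split; first lra; apply/andP; split; lra.
Qed.

Lemma size_schur s : (size (snum s) <= size s)%N /\ (size (sden s) <= (size s).-1.+1)%N.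
Proof.
elim: s => [|e s [IH1 IH2]]; first by rewrite /snum /sden /= size_poly0 size_poly1.
have h : (size ('X * snum s)%R <= (size s).+1)%N.
  by rewrite mulrC (leq_trans (size_polyMleq _ _))// size_polyX addn2.
rewrite snum_cons sden_cons /=; split.
  rewrite (leq_trans (size_polyD _ _))// geq_max h andbT.
  by rewrite (leq_trans (size_scale_leq _ _))// (leq_trans IH2)//; lia.
rewrite (leq_trans (size_polyD _ _))// geq_max (leq_trans IH2)/=; last by lia.
by rewrite (leq_trans (size_scale_leq _ _)).
Qed.

(** Each outer layer multiplies the innermost parameter by [X] once, and no other term reaches the
    top degree. Thus the core contrast is read off the numerator. *)
Lemma coef_last_snum s e : (snum (rcons s e))`_(size s) = e.
Proof.
elim: s => [|a s IH] /=.
  by rewrite snum_cons coefD coefZ coefXM /= /sden /= coef1 eqxx mulr1 addr0.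
rewrite snum_cons coefD coefZ coefXM /= IH nth_default ?mulr0 ?add0r//.
by have [_] := size_schur (rcons s e); rewrite size_rcons.
Qed.

(** If [e] is the contrast of two layers, [(1 + e) / (1 - e)] is the inner conductivity over the
    outer one, so the quotient of the two products telescopes to the core conductivity. *)
Lemma horner1_schur s :
  (sden s).[1] + (snum s).[1] = \prod_(e <- s) (1 + e) /\
  (sden s).[1] - (snum s).[1] = \prod_(e <- s) (1 - e).
Proof.
elim: s => [|e s [IH1 IH2]].
  by rewrite !big_nil /snum /sden /= !hornerE subr0.
rewrite !big_cons -IH1 -IH2 snum_cons sden_cons !(hornerD, hornerZ, hornerM, hornerX);
  split; ring.
Qed.

(** An insulating core starts the recursion at the pair [-1, 1], where [Q = - P*], and every step
    preserves this relation. *)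
Lemma schur_rconsN1 s : sden (rcons s (-1)) = - revp (size s) (snum (rcons s (-1))).
Proof.
elim: s => [|e s IH] /=.
  rewrite snum_cons sden_cons /snum /sden /= mulr0 scaler0 !addr0 scaleN1r.
  by apply/polyP => -[|i]; rewrite coefN coef_revp/= ?coefN ?coef1/= ?opprK ?oppr0.
have [h1 h2] := size_schur (rcons s (-1)).
move: h1 h2; rewrite size_rcons/= => h1 h2.
have hP : revp (size s) (snum (rcons s (-1))) = - sden (rcons s (-1)) by rewrite IH opprK.
have hQ : revp (size s) (sden (rcons s (-1))) = - snum (rcons s (-1)).
  by rewrite IH -scaleN1r revpZ revpK// scaleN1r.
by rewrite snum_cons revpD revpZ revp_widen// revpMX// sden_cons hP hQ mulrN scalerN
  -opprD opprK addrC.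
Qed.

End SchurRecursion.

(** * Schur algorithm *)

Section SchurAlgorithm.
Context {R : realFieldType}.
Implicit Types (P Q x : {poly R}) (s t : seq R) (e w : R).

Lemma norm_lt1_sqr e : (`|e| < 1) = (e ^+ 2 < 1).
Proof. by rewrite -(real_normK (num_real e)) expr_lt1. Qed.

Lemma norm_le1_sqr e : (`|e| <= 1) = (e ^+ 2 <= 1).
Proof. by rewrite -(real_normK (num_real e)) expr_le1. Qed.

Lemma coef0_sden s : (sden s)`_0 = 1.
Proof.
elim: s => [|e s IH]; first by rewrite /sden /= coef1.
by rewrite sden_cons coefD coefZ coefXM /= mulr0 addr0.
Qed.

(** Denominators have constant coefficient 1, so the constant coefficient of the numerator is the
    first parameter [e]. Once it is known to agree on both sides, the step is undone by dividing by
    [1 - e ^+ 2] and by [X]. *)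
Lemma schur_inj s t a b : size s = size t -> all (fun e => `|e| < 1) t ->
  snum (rcons s a) = snum (rcons t b) -> sden (rcons s a) = sden (rcons t b) ->
  rcons s a = rcons t b.
Proof.
elim: s t => [|e s IH] [|e' t]//=.
  rewrite !snum_cons /snum /sden /= !mulr0 !addr0 => _ _ /polyP/(_ 0%N).
  by rewrite !coefZ coef1 !mulr1 => ->.
move=> [st] /andP[e1 t1] hP hQ.
have ee : e = e'.
  move/polyP: hP => /(_ 0%N); rewrite !snum_cons !coefD !coefZ !coefXM /=.
  by rewrite !coef0_sden !mulr1 !addr0.
rewrite -ee in e1 hP hQ *; congr (_ :: _).
have d0 : 1 - e ^+ 2 != 0 by rewrite subr_eq0 gt_eqF// -norm_lt1_sqr.
move: hP hQ; rewrite !snum_cons !sden_cons => hP hQ.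
have eqN (u v : {poly R}) : v + e *: u - e *: (e *: v + u) = (1 - e ^+ 2) *: v.
  by rewrite -!mul_polyC polyCB polyC_exp; ring.
have eqD (u v : {poly R}) : (e *: v + u) - e *: (v + e *: u) = (1 - e ^+ 2) *: u.
  by rewrite -!mul_polyC polyCB polyC_exp; ring.
apply: IH => //.
  apply: (@mulfI _ 'X); first by rewrite polyX_eq0.
  by apply: (scalerI d0); rewrite -[in LHS](eqD _ (sden (rcons s a))) hP hQ eqD.
by apply: (scalerI d0); rewrite -[in LHS](eqN ('X * snum (rcons s a))) hP hQ eqN.
Qed.

Definition nsq n P : R := \sum_(i < n) P`_i ^+ 2.

(* Multiplication by the power series P/Q is a contraction of l^2, i.e. P/Q is
   a Schur function; the truncation to the first n coefficients keeps
   everything polynomial. *)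
Definition schur_class P Q := forall n x, nsq n (P * x) <= nsq n (Q * x).

Lemma nsqS n P : nsq n.+1 P = nsq n P + P`_n ^+ 2.
Proof. by rewrite /nsq big_ord_recr. Qed.

Lemma nsqXM n P : nsq n.+1 ('X * P) = nsq n P.
Proof.
rewrite /nsq big_ord_recl coefXM /= expr0n add0r.
by apply: eq_bigr => i _; rewrite coefXM.
Qed.

Lemma eq_nsq n P Q : (forall i, (i < n)%N -> P`_i = Q`_i) -> nsq n P = nsq n Q.
Proof. by move=> h; apply: eq_bigr => i _; rewrite h. Qed.

(** The freedom exploited in every use of the contraction property: if the constant coefficient of
    the multiplier is nonzero, [e] can be chosen to cancel the [n]-th coefficient of a product
    without disturbing the lower ones. *)
Lemma coef_addMXn n P Q x e : (forall i, (i < n)%N ->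
   (P * (x + e *: 'X^n))`_i = (P * x)`_i) /\
  (P * (x + e *: 'X^n))`_n = (P * x)`_n + e * P`_0.
Proof.
rewrite mulrDr -scalerAr; split => [i ilt|].
  by rewrite coefD coefZ coefMXn ilt mulr0 addr0.
by rewrite coefD coefZ coefMXn ltnn subnn.
Qed.

Lemma schur_class_coef0 P Q : schur_class P Q -> P`_0 ^+ 2 <= Q`_0 ^+ 2.
Proof. by move=> /(_ 1%N 1); rewrite !nsqS /nsq !big_ord0 !add0r !mulr1. Qed.

(* Testing with x = 1 + t X^k at the first k where P and e Q may differ, t being
   chosen so that the k-th coefficient of Q x vanishes. *)
Lemma schur_class_rigid P Q e : schur_class P Q -> Q`_0 != 0 ->
  e ^+ 2 = 1 -> P`_0 = e * Q`_0 -> P = e *: Q.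
Proof.
move=> K Q0 e1 P0; apply/polyP => k; elim/ltn_ind: k => k IH; rewrite coefZ.
case: (posnP k) => [->//|k0].
pose t := - Q`_k / Q`_0.
have [P1 P2] := coef_addMXn k P Q 1 t.
have [Q1 Q2] := coef_addMXn k Q Q 1 t.
have := K k.+1 (1 + t *: 'X^k).
rewrite !nsqS P2 Q2 !mulr1 (@eq_nsq k (P * _) P); last by move=> i /P1; rewrite mulr1.
rewrite (@eq_nsq k (Q * _) Q); last by move=> i /Q1; rewrite mulr1.
have -> : nsq k P = nsq k Q.
  by apply: eq_bigr => i _; rewrite IH// coefZ exprMn e1 mul1r.
have -> : Q`_k + t * Q`_0 = 0 by rewrite /t divfK// subrr.
rewrite expr0n/= lerD2l => h.
have /eqP : (P`_k + t * P`_0) ^+ 2 = 0 by apply/le_anti; rewrite h sqr_ge0.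
rewrite sqrf_eq0 P0 mulrCA [t * _]divfK// mulrN subr_eq0 => /eqP->//.
Qed.

Lemma schur_classM P1 Q1 P2 Q2 : schur_class P1 Q1 -> schur_class P2 Q2 ->
  schur_class (P1 * P2) (Q1 * Q2).
Proof.
move=> K1 K2 n x; rewrite -mulrA (le_trans (K1 _ _))// mulrCA (le_trans (K2 _ _))//.
by rewrite mulrCA mulrA.
Qed.

Lemma schur_classZ c P Q : schur_class P Q -> schur_class (c *: P) (c *: Q).
Proof.
move=> K n x; rewrite -!scalerAl.
have h U : nsq n (c *: U) = c ^+ 2 * nsq n U.
  by rewrite /nsq mulr_sumr; apply: eq_bigr => i _; rewrite coefZ exprMn.
by rewrite !h ler_wpM2l ?sqr_ge0//; exact: K.
Qed.

(* |Q - e P|^2 - |P - e Q|^2 = (1 - e^2) (|Q|^2 - |P|^2); dividing P - e Q by X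
   loses one coefficient, which is recovered by adjusting x so that the n-th
   coefficient of (Q - e P) x vanishes. *)
Lemma schur_class_step P Q P' e : schur_class P Q -> e ^+ 2 <= 1 ->
  (Q - e *: P)`_0 != 0 -> 'X * P' = P - e *: Q -> schur_class P' (Q - e *: P).
Proof.
move=> K e1 Q0 hP' n x.
have [P1 P2] := coef_addMXn n ('X * P') P x (- ((Q - e *: P) * x)`_n / (Q - e *: P)`_0).
have [Q1 Q2] := coef_addMXn n (Q - e *: P) Q x (- ((Q - e *: P) * x)`_n / (Q - e *: P)`_0).
move: P1 P2 Q1 Q2; set y := (x + _ *: _) => P1 P2 Q1 Q2.
have {}Q2 : ((Q - e *: P) * y)`_n = 0 by rewrite Q2 divfK// subrr.
rewrite -[leRHS](@eq_nsq _ ((Q - e *: P) * y))// -nsqXM.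
have -> : nsq n.+1 ('X * (P' * x)) = nsq n.+1 ('X * (P' * y)).
  rewrite !nsqS mulrA (@eq_nsq _ _ (('X * P') * y)) => [|i /P1//].
  by rewrite mulrA P2 coefXM eqxx mulr0 addr0.
have -> : nsq n ((Q - e *: P) * y) = nsq n.+1 ((Q - e *: P) * y).
  by rewrite nsqS Q2 expr0n addr0.
rewrite mulrA hP' -subr_ge0.
have -> : nsq n.+1 ((Q - e *: P) * y) - nsq n.+1 ((P - e *: Q) * y) =
    (1 - e ^+ 2) * (nsq n.+1 (Q * y) - nsq n.+1 (P * y)).
  rewrite /nsq -!sumrB mulr_sumr; apply: eq_bigr => i _.
  have E U V : ((U - e *: V) * y)`_i = (U * y)`_i - e * (V * y)`_i.
    by rewrite mulrBl -scalerAl coefB coefZ.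
  by rewrite !E; ring.
by rewrite mulr_ge0// subr_ge0//; exact: K.
Qed.

(** Induction on the degree peels off the outermost parameter [e = P(0) / Q(0)], leaving
    [(P - e Q) / X] and [Q - e P]. As long as the degree is positive, [|e| = 1] is impossible: by
    rigidity it would make [P] a multiple of [Q], against coprimality. Only the last parameter may
    have modulus 1. *)
Lemma schur_algorithm m P Q k : size P = m.+1 -> (size Q <= m.+1)%N ->
  coprimep P Q -> schur_class P Q -> Q`_0 != 0 ->
  Q * revp m Q = P * revp m P + k *: 'X^m ->
  exists s e c, [/\ size s = m, all (fun e => `|e| < 1) s, `|e| <= 1, c != 0 &
    P = c *: snum (rcons s e) /\ Q = c *: sden (rcons s e)].
Proof.
elim: m P Q k => [|m IH] P Q k sP sQ cPQ K Q0 hPQ.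
  have h0 : (P`_0 / Q`_0) ^+ 2 <= 1.
    rewrite expr_div_n ler_pdivrMr ?mul1r ?schur_class_coef0//.
    by rewrite lt_neqAle sqr_ge0 eq_sym sqrf_eq0 Q0.
  exists [::], (P`_0 / Q`_0), Q`_0; split => //.
    by rewrite norm_le1_sqr.
  rewrite /= snum_cons sden_cons /snum /sden /= mulr0 !scaler0 !addr0 scalerA mulrC divfK//.
  split; first by rewrite {1}(size1_polyC (p:=P)) ?sP// alg_polyC.
  by rewrite {1}(size1_polyC sQ) alg_polyC.
pose e := P`_0 / Q`_0.
have hP0 : P`_0 = e * Q`_0 by rewrite divfK.
have e2 : e ^+ 2 <= 1.
  rewrite expr_div_n ler_pdivrMr ?mul1r ?schur_class_coef0//.
  by rewrite lt_neqAle sqr_ge0 eq_sym sqrf_eq0 Q0.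
have {}e2 : e ^+ 2 < 1.
  rewrite lt_neqAle e2 andbT; apply/eqP => e1.
  have PQ := schur_class_rigid K Q0 e1 hP0.
  have e0 : e != 0 by rewrite -sqrf_eq0 e1 oner_eq0.
  by move: cPQ sP; rewrite PQ coprimepZl// coprimepp size_scale// => /eqP->.
have d0 : 1 - e ^+ 2 != 0 by rewrite subr_eq0 gt_eqF.
(* The constant coefficient of the identity reads [Q(0) Q_(m+1) = P(0) P_(m+1)]; hence the top
   coefficient of [Q - e P] cancels and the degree bound drops. *)
have hQm : Q`_m.+1 = e * P`_m.+1.
  move/polyP: hPQ => /(_ 0%N);
    rewrite coefD coefZ coefXn !coef0M !coef_revp/= mulr0 addr0 subn0 hP0.
  by move=> h; apply: (mulfI Q0); rewrite h; ring.
pose Q' := Q - e *: P.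
pose S := P - e *: Q.
pose P' := drop_poly 1 S.
have hS : 'X * P' = S.
  rewrite -[RHS](poly_take_drop 1) expr1 mulrC;
    suff -> : take_poly 1 S = 0 by rewrite add0r.
  apply/polyP => -[|i]; rewrite coef_take_poly coef0//= coefB coefZ hP0 subrr//.
have hQ'0 : Q'`_0 = (1 - e ^+ 2) * Q`_0 by rewrite coefB coefZ hP0; ring.
have hcP : (1 - e ^+ 2) *: P = e *: Q' + 'X * P'.
  by rewrite hS /S /Q' -!mul_polyC polyCB polyC_exp; ring.
have hcQ : (1 - e ^+ 2) *: Q = Q' + e *: ('X * P').
  by rewrite hS /S /Q' -!mul_polyC polyCB polyC_exp; ring.
have sQ' : (size Q' <= m.+1)%N.
  apply/leq_sizeP => j; rewrite leq_eqVlt => /orP[/eqP<-|jm].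
    by rewrite coefB coefZ hQm subrr.
  by rewrite coefB coefZ !nth_default ?mulr0 ?subrr// ?sP// (leq_trans sQ).
have sS : size S = m.+2.
  apply/anti_leq; rewrite -sP (leq_trans (size_polyD _ _)) ?geq_max ?leqnn//=; last first.
    by rewrite size_polyN (leq_trans (size_scale_leq _ _))// sP.
  rewrite sP ltnNge; apply/negP => /leq_sizeP/(_ _ (leqnn _)).
  rewrite coefB coefZ hQm => /eqP; apply/negP.
  have -> : P`_m.+1 - e * (e * P`_m.+1) = (1 - e ^+ 2) * P`_m.+1 by ring.
  by rewrite mulf_neq0// -[m.+1]/(m.+2.-1) -sP -lead_coefE lead_coef_eq0 -size_poly_gt0 sP.
have sP' : size P' = m.+1 by rewrite size_drop_poly sS.
have [] := IH P' Q' ((1 - e ^+ 2) * k) => //.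
- apply/coprimepP => d dP dQ; move/coprimepP: cPQ; apply.
    by rewrite -(dvdpZr _ _ d0) hcP -mul_polyC dvdp_add// dvdp_mull.
  by rewrite -(dvdpZr _ _ d0) hcQ -mul_polyC dvdp_add// !dvdp_mull.
- by apply: schur_class_step => //; rewrite ?ltW// -/Q' hQ'0 mulf_neq0.
- by rewrite hQ'0 mulf_neq0.
(* After multiplication by [X] both reversals can be taken in nominal degree [m.+1], where the new
   identity is [1 - e ^+ 2] times the old one. *)
- apply: (@mulfI _ 'X); first by rewrite polyX_eq0.
  have -> : 'X * (Q' * revp m Q') = Q' * revp m.+1 Q' by rewrite revp_widen// mulrCA.
  rewrite mulrDr mulrA -(@revpMX _ m) ?sP'// hS -scalerAr -exprS -scalerA.
  have -> : k *: 'X^(m.+1) = Q * revp m.+1 Q - P * revp m.+1 P.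
    by rewrite hPQ addrC addKr.
  rewrite /Q' /S !(revpD, revpN, revpZ) -!mul_polyC polyCB polyC_exp; ring.
move=> s [a [c [ss s1 a1 c0 [hP hQ]]]].
exists (e :: s), a, (c / (1 - e ^+ 2)); split => //=; first by rewrite ss.
- by rewrite s1 andbT norm_lt1_sqr.
- by rewrite mulf_neq0// invr_eq0.
split; apply: (scalerI d0); rewrite scalerA mulrC divfK//.
  by rewrite hcP snum_cons hP hQ scalerDr !scalerA (mulrC c) -scalerAr.
by rewrite hcQ sden_cons hP hQ scalerDr !scalerA -scalerAr scalerA (mulrC c).
Qed.

End SchurAlgorithm.

(** * Schur functions with zero-free denominator *)

Section Outer.
Context {R : realType}.
Local Notation C := R[i].
Local Notation toC := (real_complex R).
Local Notation cRe := (@complex.Re R).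
Local Notation cIm := (@complex.Im R).
Implicit Types (P Q x : {poly R}) (p q : {poly C}) (a : C) (s : seq C).

Lemma coef_cancel n Q x : Q`_0 != 0 ->
  (forall i, (i < n)%N -> (Q * x)`_i = 0) -> forall i, (i < n)%N -> x`_i = 0.
Proof.
move=> Q0 h i; elim/ltn_ind: i => i IH iltn.
have := h i iltn; rewrite coefM big_ord_recl subn0 big1 ?addr0 => [/eqP|j _].
  by rewrite mulf_eq0 (negbTE Q0) => /eqP.
have ji : (i - lift ord0 j < i)%N by rewrite ltn_subrL lift0/= (leq_ltn_trans _ (ltn_ord
  j)).
by rewrite IH ?mulr0// (ltn_trans ji).
Qed.

Lemma coefM_low n P x : (forall i, (i < n)%N -> x`_i = 0) ->
  forall i, (i < n)%N -> (P * x)`_i = 0.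
Proof.
move=> h i ilt; rewrite coefM big1// => j _.
by rewrite h ?mulr0// (leq_ltn_trans (leq_subr _ _)).
Qed.

Definition nsqc n p : R := \sum_(i < n) normc p`_i ^+ 2.

Lemma normc_ge0 a : 0 <= normc a.
Proof. by case: a => *; rewrite sqrtr_ge0. Qed.

Lemma normcX a n : normc (a ^+ n) = normc a ^+ n.
Proof. by elim: n => [|n IH]; rewrite ?expr0 ?normc1// !exprS normcM IH. Qed.

Lemma sqr_normcE a : normc a ^+ 2 = cRe a ^+ 2 + cIm a ^+ 2.
Proof. by case: a => u v /=; rewrite sqr_sqrtr// addr_ge0 ?sqr_ge0. Qed.

(** Shifting by [K] does not increase the truncated norm, so this is the triangle inequality. It is
    done coefficientwise through the convexity bound [(v + z u)^2 <= (1 + z) (v^2 + z u^2)], which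
    can simply be summed. *)
Lemma nsqc_mul_1subXn n K a p :
  nsqc n (p * (1 - a *: 'X^K)) <= (1 + normc a) ^+ 2 * nsqc n p.
Proof.
have a0 := normc_ge0 a.
pose sh i := if (i < K)%N then 0 else normc p`_(i - K) ^+ 2.
have h i : normc (p * (1 - a *: 'X^K))`_i ^+ 2 <=
    (1 + normc a) * (normc p`_i ^+ 2 + normc a * sh i).
  rewrite mulrBr mulr1 coefB -scalerAr coefZ coefMXn /sh.
  case: ifP => _.
    by rewrite !mulr0 subr0 addr0 ler_peMl ?sqr_ge0// lerDl.
  have t := le_normcD p`_i (- (a * p`_(i - K))).
  move: t; rewrite normcN normcM.
  have := normc_ge0 p`_i; have := normc_ge0 p`_(i - K).
  have := normc_ge0 (p`_i - a * p`_(i - K)).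
  move: (normc (p`_i - _)) (normc p`_i) (normc p`_(i - K)) (normc a) a0 =>
    w v u z z0 w0 u0 v0 t.
  have t2 : w ^+ 2 <= (v + z * u) ^+ 2 by rewrite !expr2 ler_pM.
  have : 0 <= z * (v - u) ^+ 2 by rewrite mulr_ge0// sqr_ge0.
  by nra.
have hs : \sum_(i < n) sh i <= nsqc n p.
  have [nK|Kn] := leqP n K.
    rewrite big1 => [|i _]; first by apply: sumr_ge0 => i _; rewrite sqr_ge0.
    by rewrite /sh (leq_trans (ltn_ord i) nK).
  rewrite /nsqc -(big_mkord xpredT sh) -(big_mkord xpredT (fun i => normc p`_i ^+ 2)).
  rewrite (big_cat_nat (n:=K))//=; last exact: ltnW.
  rewrite big_nat_cond big1 ?add0r => [|i]; last by rewrite andbT /sh /= => ->.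
  rewrite -{1}[K]add0n big_addn [leRHS](big_cat_nat (n:=(n - K)%N))//=; last by lia.
  rewrite (eq_bigr (fun i => normc p`_i ^+ 2)) ?lerDl => [|i _].
    by apply: sumr_ge0 => i _; rewrite sqr_ge0.
  by rewrite /sh ltnNge leq_addl/= addnK.
have := @ler_sum R _ (index_enum 'I_n) xpredT _ _ (fun i _ => h (i : 'I_n)).
move=> /le_trans; apply; rewrite -mulr_sumr big_split/= -mulr_sumr -/(nsqc n p) expr2
  -mulrA.
rewrite ler_wpM2l ?addr_ge0// mulrDl mul1r lerD2l.
by rewrite ler_wpM2l.
Qed.

(* Divisible by prod (1 - a X), and close to 1 in l^2 for large K when |a| < 1;
   the quotient serves as an approximate inverse of prod (1 - a X). *)
Definition approx_one s K : {poly C} := \prod_(a <- s) (1 - a ^+ K *: 'X^K).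

Lemma nsqc_approx_one n s K p :
  nsqc n (p * approx_one s K) <=
  (\prod_(a <- s) (1 + normc a ^+ K)) ^+ 2 * nsqc n p.
Proof.
rewrite /approx_one; elim: s p => [|a s IH] p.
  by rewrite !big_nil mulr1 expr1n mul1r.
rewrite !big_cons mulrA (le_trans (IH _))//.
rewrite [leRHS](_ : _ = (\prod_(b <- s) (1 + normc b ^+ K)) ^+ 2 *
  ((1 + normc a ^+ K) ^+ 2 * nsqc n p)); last by ring.
rewrite ler_wpM2l ?sqr_ge0// -normcX; exact: nsqc_mul_1subXn.
Qed.

Lemma approx_one_low s K : exists q, approx_one s K = 1 + 'X^K * q.
Proof.
rewrite /approx_one; elim: s => [|a s [q hq]].
  by exists 0; rewrite big_nil mulr0 addr0.
exists (q - (a ^+ K)%:P * (1 + 'X^K * q)).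
by rewrite big_cons hq -mul_polyC; ring.
Qed.

Lemma approx_one_dvd s K : (0 < K)%N ->
  exists q, approx_one s K = (\prod_(a <- s) (1 - a *: 'X)) * q.
Proof.
move=> K0; rewrite /approx_one; elim: s => [|a s [q hq]].
  by exists 1; rewrite !big_nil mulr1.
exists (q * (\sum_(i < K) 1 ^+ (K.-1 - i) * (a *: 'X) ^+ i)).
rewrite !big_cons hq -exprZn -{1}(expr1n _ K) subrXX_comm; last exact: mulrC.
by rewrite -!mulrA; congr (_ * _); rewrite mulrC -mulrA.
Qed.

Lemma cvg_approx_bound s : all (fun a => normc a < 1) s ->
  (\prod_(a <- s) (1 + normc a ^+ K)) ^+ 2 @[K --> \oo] --> (1 : R).
Proof.
move=> s1.
have h : \prod_(a <- s) (1 + normc a ^+ K) @[K --> \oo] --> (1 : R).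
  elim: s s1 => [|a s IH] /=.
    by move=> _; under eq_fun do rewrite big_nil; exact: cvg_cst.
  move=> /andP[a1 s1]; under eq_fun do rewrite big_cons.
  have ha : (1 + normc a ^+ K) @[K --> \oo] --> (1 + 0 : R).
    by apply: cvgD; [exact: cvg_cst|apply: cvg_expr; rewrite ger0_norm// normc_ge0].
  rewrite addr0 in ha; have := cvgM ha (IH s1); rewrite mulr1; exact.
by under eq_fun do rewrite expr2; have := cvgM h h; rewrite mulr1; exact.
Qed.

(** The coefficient of degree [e] in [p * revp e p] is the full squared norm of [p]. Applied to
    [Q x] and [P x], the identity therefore says that their squared norms differ by [k] times that
    of [x]. *)
Lemma nsq_energy N P Q k x n : (size P <= N.+1)%N -> (size Q <= N.+1)%N ->
  0 <= k -> Q * revp N Q = P * revp N P + k *: 'X^N ->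
  exists2 m, (n <= m)%N & nsq m (P * x) <= nsq m (Q * x).
Proof.
move=> sP sQ k0 h; pose d := (n + size x)%N.
have sx : (size x <= d.+1)%N by rewrite /d; lia.
have nsqE e (p : {poly R}) : (p * revp e p)`_e = nsq e.+1 p.
  rewrite coefM; apply: eq_bigr => i _; rewrite coef_revp leq_subr.
  by rewrite subKn -?expr2// -ltnS.
exists (N + d).+1; first by rewrite /d; lia.
rewrite -!nsqE !(@revpM _ N d)// -subr_ge0 -coefB.
have -> : Q * x * (revp N Q * revp d x) - P * x * (revp N P * revp d x) =
    (k *: (x * revp d x)) * 'X^N.
  have -> : Q * x * (revp N Q * revp d x) = (Q * revp N Q) * (x * revp d x) by ring.
  by rewrite h -!mul_polyC; ring.
rewrite coefMXn ltnNge leq_addr/= addKn coefZ nsqE mulr_ge0//.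
by apply: sumr_ge0 => i _; rewrite sqr_ge0.
Qed.

(** To truncate the energy inequality, [x] is replaced by [y * u] with [y] the truncation of [Q x]
    and [u] an approximate inverse of [Q]. This agrees with [x] below degree [n], while
    [Q * (y * u)] has total norm at most that of [y] times a factor tending to 1 with [K], as the
    [a] in [s] have modulus below 1. *)
Lemma schur_class_outer N P Q k s c : (size P <= N.+1)%N -> (size Q <= N.+1)%N ->
  0 <= k -> Q * revp N Q = P * revp N P + k *: 'X^N -> c != 0 ->
  map_poly toC Q = c *: \prod_(a <- s) (1 - a *: 'X) ->
  all (fun a => normc a < 1) s -> schur_class P Q.
Proof.
move=> sP sQ k0 h c0 hQ s1 n x.
have Q0 : Q`_0 != 0.
  have : (map_poly toC Q)`_0 != 0.
    rewrite hQ coefZ mulf_neq0// coef0_prod prodf_seq_neq0.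
    by apply/allP => a _; rewrite !coefE mulr0 subr0 oner_neq0.
  by rewrite coef_map fmorph_eq0.
pose y := take_poly n (Q * x).
have ylow i : (i < n)%N -> y`_i = (Q * x)`_i by rewrite coef_take_poly => ->.
suff key K : (n < K)%N ->
    nsq n (P * x) <= (\prod_(a <- s) (1 + normc a ^+ K)) ^+ 2 * nsq n (Q * x).
  have cv : (\prod_(a <- s) (1 + normc a ^+ K)) ^+ 2 * nsq n (Q * x) @[K --> \oo] -->
      nsq n (Q * x).
    have := cvgM (cvg_approx_bound s1) (@cvg_cst _ (nsq n (Q * x)) _ \oo _).
    by rewrite mul1r; exact.
  rewrite -(cvg_lim _ cv)//; apply: limr_ge; first by apply/cvg_ex; eexists; exact: cv.
  by exists n.+1 => // K /= nK; exact: key.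
move=> nK.
have [q hq] : exists q, approx_one s K = map_poly toC Q * q.
  have [|q hq] := @approx_one_dvd s K; first by rewrite (leq_trans _ nK).
  by exists (c^-1 *: q); rewrite hQ hq -scalerAl -scalerAr scalerA mulfV// scale1r.
(* The cofactor [q] may be complex. As [Q] and [y] are real, taking real parts of coefficients
   commutes with multiplying by them and only decreases norms. *)
pose u := map_poly (cRe) q : {poly R}.
have uE i : u`_i = cRe q`_i by rewrite coef_map_id0.
have ReM b a : cRe (toC b * a) = b * cRe a by case: a => a1 a2 /=; rewrite mul0r subr0.
have ReMu z i : (z * u)`_i = cRe (map_poly toC z * q)`_i.
  rewrite !coefM raddf_sum/=; apply: eq_bigr => j _.
  by rewrite uE coef_map; exact/esym/ReM.
have [g hg] := approx_one_low s K.
have Qu i : (i < n)%N -> (Q * u)`_i = (i == 0)%:R.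
  move=> iltn; rewrite ReMu -hq hg coefD coefXnM (ltn_trans iltn nK) addr0 coef1.
  by case: eqP.
have low i : (i < n)%N -> (x - y * u)`_i = 0.
  apply: coef_cancel Q0 _ i => i iltn.
  rewrite (_ : Q * _ = Q * x - y * (Q * u)); last by ring.
  rewrite coefB [(y * _)`_i]coefM (bigD1 ord_max)//= subnn Qu ?(leq_ltn_trans _ iltn)//
    mulr1.
  rewrite big1 ?addr0 ?ylow ?subrr// => j ji.
  rewrite Qu; last by rewrite (leq_ltn_trans _ iltn)// leq_subr.
  rewrite subn_eq0 leqNgt ltn_neqAle -ltnS ltn_ord andbT.
  by move: ji; rewrite -(inj_eq val_inj)/= => ->; rewrite mulr0.
have -> : nsq n (P * x) = nsq n (P * (y * u)).
  apply: eq_nsq => i iltn; apply/eqP; rewrite -subr_eq0 -coefB -mulrBr.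
  by apply/eqP; exact: coefM_low low _ iltn.
have [m nm hm] := nsq_energy (y * u) n sP sQ k0 h.
have nsq_le i j (p : {poly R}) : (i <= j)%N -> nsq i p <= nsq j p.
  move=> /subnKC <-; elim: (j - i)%N => [|l IH]; rewrite ?addn0// addnS nsqS.
  by rewrite ler_wpDr// sqr_ge0.
apply: (le_trans (nsq_le _ _ _ nm)); apply: (le_trans hm).
have -> : Q * (y * u) = y * (Q * u) by ring.
apply: (@le_trans _ _ (nsqc m (map_poly toC y * approx_one s K))).
  apply: ler_sum => i _; rewrite sqr_normcE.
  have -> : (y * (Q * u))`_i = cRe (map_poly toC y * approx_one s K)`_i.
    rewrite !coefM raddf_sum/=; apply: eq_bigr => j _.
    by rewrite coef_map hq ReMu; exact/esym/ReM.
  by rewrite lerDl sqr_ge0.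
rewrite (le_trans (nsqc_approx_one _ _ _ _))// ler_wpM2l ?sqr_ge0//.
have -> : nsqc m (map_poly toC y) = nsq m y.
  by apply: eq_bigr => i _; rewrite sqr_normcE coef_map/= expr0n addr0.
have -> : nsq m y = nsq n y.
  move: nm => /subnKC <-; elim: (m - n)%N => [|j IH]; rewrite ?addn0// addnS nsqS IH.
  by rewrite coef_take_poly ltnNge leq_addr expr0n addr0.
by rewrite (eq_nsq ylow).
Qed.

End Outer.

(** * Fejer-Riesz factorization *)

Section FejerRiesz.
Context {R : realType}.
Local Notation C := R[i].
Local Notation toC := (real_complex R).
Local Notation cRe := (@complex.Re R).
Implicit Types (P Q x : {poly R}) (p q : {poly C}) (a : C) (s : seq C).

Lemma map_revp N P : map_poly toC (revp N P) = revp N (map_poly toC P).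
Proof. by apply/polyP => i; rewrite coef_map !coef_revp coef_map; case: ifP;
  rewrite ?rmorph0. Qed.

Lemma conj_fixed_real p : map_poly conjc p = p -> exists P, p = map_poly toC P.
Proof.
move=> h; exists (map_poly cRe p); apply/polyP => i.
rewrite coef_map coef_map_id0//=; move/polyP: h => /(_ i).
rewrite coef_map/=; case: (p`_i) => u v /= [] v0.
by congr (_ +i* _)%C; lra.
Qed.

Lemma normcJ a : normc (conjc a) = normc a.
Proof. by case: a => u v /=; rewrite sqrrN. Qed.

Lemma root_map_conj p a : root (map_poly conjc p) a -> root p (conjc a).
Proof. by rewrite -{1}(conjcK a) /root horner_map fmorph_eq0. Qed.

(** Conjugation preserves the modulus, so the conjugate of the product over the inner roots is
    coprime to [q]. It divides the real polynomial [p], hence the product itself, and both are monic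
    of the same degree. *)
Lemma map_poly_fixed_dvd p q s : map_poly conjc p = p -> p = q * \prod_(a <- s) ('X -
  a%:P) ->
  all (fun a => normc a < 1) s -> (forall a, root q a -> ~~ (normc a < 1)) ->
  q != 0 ->
  map_poly conjc (\prod_(a <- s) ('X - a%:P)) = \prod_(a <- s) ('X - a%:P).
Proof.
set E := \prod_(a <- s) _ => hp hE s1 hq q0.
have rE a : root E a -> normc a < 1.
  by rewrite root_prod_XsubC => /(allP s1).
have cop : coprimep (map_poly conjc E) q.
  apply: Pdiv.ClosedField.root_coprimep => a /root_map_conj/rE; rewrite normcJ => a1.
  by apply/negP => /hq; rewrite a1.
have : map_poly conjc E %| E.
  rewrite -(Gauss_dvdpr _ cop) -hE -hp hE rmorphM/=; exact: dvdp_mulIr.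
have sE : size (map_poly conjc E) = size E by rewrite size_map_poly.
move=> /dvdp_size_eqp; rewrite sE eqxx => /esym.
by rewrite eqp_monic ?map_monic ?monic_prod_XsubC// => /eqP.
Qed.

(* With E and D the products over the roots inside and outside the unit circle,
   F = F* and coprimality force D to be a multiple of E*. *)
Lemma fejer_riesz N (F : {poly R}) : size F = (N + N).+1 -> revp (N + N) F = F ->
  F.[1] = 1 -> (forall a, normc a = 1 -> (map_poly toC F).[a] != 0) ->
  exists Q s c, [/\ (size Q <= N.+1)%N, Q * revp N Q = F, Q.[1] = 1, c != 0 &
    map_poly toC Q = c *: \prod_(a <- s) (1 - a *: 'X) /\
    all (fun a => normc a < 1) s].
Proof.
move=> sF rF F1 hF.
set G := map_poly toC F in hF.
have [r hr] := closed_field_poly_normal G.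
have G0 : G != 0 by rewrite map_poly_eq0 -size_poly_gt0 sF.
have l0 : lead_coef G != 0 by rewrite lead_coef_eq0.
have rG : revp (N + N) G = G by rewrite -map_revp rF.
pose si := [seq a <- r | normc a < 1]; pose so := [seq a <- r | ~~ (normc a < 1)].
pose E : {poly C} := \prod_(a <- si) ('X - a%:P).
pose D : {poly C} := \prod_(a <- so) ('X - a%:P).
have hG : G = lead_coef G *: D * E.
  rewrite {1}hr -scalerAl; congr (_ *: _).
  by rewrite /E /D !big_filter mulrC [LHS](bigID (fun a => normc a < 1)).
have rD a : root D a -> 1 < normc a.
  rewrite root_prod_XsubC mem_filter -leNgt lt_neqAle => /andP[-> ar]; rewrite andbT.
  apply/eqP => /esym/hF; rewrite hr hornerZ => /eqP; apply; apply/eqP.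
  by rewrite mulf_eq0 -rootE root_prod_XsubC ar orbT.
have rE a : root E a -> normc a < 1 by rewrite root_prod_XsubC mem_filter => /andP[].
have si1 : all (fun a => normc a < 1) si by apply/allP => a; rewrite mem_filter => /andP[].
have D0 : D != 0 by rewrite monic_neq0 ?monic_prod_XsubC.
have E0 : E != 0 by rewrite monic_neq0 ?monic_prod_XsubC.
have hcE : map_poly conjc E = E.
  apply: (map_poly_fixed_dvd (p := G) (q := lead_coef G *: D)) => //.
  - apply/polyP => i; rewrite coef_map /G coef_map/=.
    by rewrite oppr0.
  - by move=> a; rewrite rootZ// => /rD; rewrite -leNgt; apply: ltW.
  - by rewrite scaler_eq0 negb_or l0.
have [e he] := conj_fixed_real hcE.
have sr : (size so + size si)%N = (N + N)%N.
  apply: succn_inj; rewrite -sF -(size_map_poly toC) -/G hr size_scale// size_prod_XsubC.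
  by rewrite -size_cat; congr _.+1; apply: perm_size; rewrite perm_catC perm_filterC.
have sE : size E = (size si).+1 by rewrite size_prod_XsubC.
have sD : size D = (size so).+1 by rewrite size_prod_XsubC.
have rG2 : lead_coef G *: (revp (size so) D * revp (size si) E) = lead_coef G *: (D * E).
  have hG' : lead_coef G *: (D * E) = G by rewrite scalerAl -hG.
  by rewrite -revpM ?sE ?sD// sr -revpZ hG' rG.
move: rG2 => /(scalerI l0) rG2.
have rrE a : root (revp (size si) E) a -> 1 < normc a.
  have [->|a0] := eqVneq a 0.
    rewrite rootE horner_coef0 coef_revp subn0/= -[size si]/(size si).+1.-1 -sE -lead_coefE.
    by rewrite lead_coef_eq0 (negbTE E0).
  rewrite rootE horner_revp ?sE// mulf_eq0 expf_eq0 (negbTE a0) andbF/= -rootE => /rE.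
  rewrite normcV invf_lt1//; first by rewrite lt_neqAle normc_ge0 eq_sym andbT;
    apply: contra a0 => /eqP/eq0_normc->.
have rrD a : root (revp (size so) D) a -> normc a < 1.
  have [->|a0] := eqVneq a 0.
    by rewrite normc0 ltr01.
  rewrite rootE horner_revp ?sD// mulf_eq0 expf_eq0 (negbTE a0) andbF/= -rootE => /rD.
  rewrite normcV invf_gt1//; first by rewrite lt_neqAle normc_ge0 eq_sym andbT;
    apply: contra a0 => /eqP/eq0_normc->.
have DrE : D %| revp (size si) E.
  have cop : coprimep D (revp (size so) D).
    apply: Pdiv.ClosedField.root_coprimep => a /rD a1.
    by apply/negP => /rrD /(lt_trans a1); rewrite ltxx.
  by rewrite -(Gauss_dvdpr _ cop) rG2 dvdp_mulIl.
have rED : revp (size si) E %| D.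
  have cop : coprimep (revp (size si) E) E.
    apply: Pdiv.ClosedField.root_coprimep => a /rrE a1.
    by apply/negP => /rE /(lt_trans a1); rewrite ltxx.
  by rewrite -(Gauss_dvdpl _ cop) -rG2 dvdp_mulIr.
have /eqpf_eq[mu mu0 hD] : D %= revp (size si) E by rewrite /eqp DrE rED.
have rE0 : revp (size si) E != 0 by move: D0; rewrite hD scaler_eq0 negb_or => /andP[].
have ErD : E %| revp (size so) D.
  have cop : coprimep E (revp (size si) E).
    apply: Pdiv.ClosedField.root_coprimep => a /rE a1.
    by apply/negP => /rrE /(lt_trans a1); rewrite ltxx.
  by rewrite -(Gauss_dvdpl _ cop) rG2 dvdp_mulIr.
have rD0 : revp (size so) D != 0.
  apply: contraTneq G0 => h; rewrite hG -scalerAl; move: rG2; rewrite h mul0r => <-.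
  by rewrite scaler0 eqxx.
(* [D] divides the reversal of [E] and [E] divides that of [D], so there are as many roots inside
   the circle as outside. *)
have siN : size si = N.
  have h1 : (size so <= size si)%N.
    by rewrite -ltnS -sD (leq_trans (dvdp_leq rE0 DrE))// size_revp.
  have h2 : (size si <= size so)%N.
    by rewrite -ltnS -sE (leq_trans (dvdp_leq rD0 ErD))// size_revp.
  by move: sr h1 h2; lia.
move: hD hG sE; rewrite siN => hD hG sE.
have se : size e = N.+1 by rewrite -sE he size_map_poly.
have hG1 : G = (lead_coef G * mu) *: map_poly toC (revp N e * e).
  by rewrite rmorphM/= map_revp -he scalerAl -scalerA -hD.
have e1 : e.[1] != 0.
  move: hG1 => /(congr1 (fun p => p.[1]));
    rewrite /G -[1 in LHS](rmorph1 toC) horner_map/= F1.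
  rewrite hornerZ -[1 in RHS](rmorph1 toC) horner_map/= hornerM => h; apply/eqP => e10.
  by move: h; rewrite e10 mulr0 rmorph0 mulr0 => /eqP; rewrite fmorph_eq0 oner_eq0.
(* Evaluation at 1, where [F] has value 1, shows the remaining constant to be the square of a real
   number, so it can be shared between the two factors. *)
have hc : lead_coef G * mu = toC (e.[1] ^- 2).
  move: hG1 => /(congr1 (fun p => p.[1]));
    rewrite {1}/G -[1 in LHS](rmorph1 toC) horner_map/= F1.
  rewrite hornerZ -[1 in RHS](rmorph1 toC) horner_map/= hornerM horner_revp1 ?se// => h.
  rewrite fmorphV; apply: (mulIf (x := toC (e.[1] ^+ 2))).
    by rewrite fmorph_eq0 expf_neq0.
  by rewrite mulVf ?fmorph_eq0 ?expf_neq0// expr2 -h.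
(* The reversal of the inner factor is chosen: its roots are the inverses of the inner ones, hence
   outside the disk. The scalar gives value 1 at 1. *)
exists (e.[1]^-1 *: revp N e), si, (toC e.[1]^-1); split.
- by rewrite (leq_trans (size_scale_leq _ _))// size_revp.
- rewrite revpZ revpK ?se// -scalerAl -scalerAr scalerA -invfM -expr2.
  apply: (map_inj_poly (f := toC)) => //; first exact: complexI.
  by rewrite -/G hG1 hc map_polyZ.
- by rewrite hornerZ horner_revp1 ?se// mulVf.
- by rewrite fmorph_eq0 invr_eq0.
split => //; rewrite map_polyZ; congr (_ *: _).
by rewrite map_revp -he -{1}siN revp_prod_XsubC.
Qed.

End FejerRiesz.

(** * Contrasts and conductivities with prescribed zeros *)

Section VanishingContrasts.
Context {R : realType}.
Local Notation C := R[i].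
Local Notation toC := (real_complex R).
Implicit Types (P Q x : {poly R}) (s z : seq R).

(** The two factors are reversals of each other, so the cross terms agree up to a boundary
    contribution: the difference telescopes to its last term. *)
Lemma nsq_blaschke_factor n (b : R) x :
  nsq n.+1 ((1 - b *: 'X) * x) - nsq n.+1 (('X - b%:P) * x) =
  (1 - b ^+ 2) * x`_n ^+ 2.
Proof.
rewrite !mulrBl mul1r -scalerAl mul_polyC.
elim: n => [|n IH]; rewrite [nsq _ (x - _)]nsqS [nsq _ (_ - b *: x)]nsqS.
  by rewrite /nsq !big_ord0 !coefB !coefZ !coefXM/=; ring.
by rewrite opprD addrACA IH !coefB !coefZ !coefXM/=; ring.
Qed.

Lemma schur_class_blaschke z : all (fun b => `|b| < 1) z ->
  schur_class (\prod_(b <- z) ('X - b%:P)) (\prod_(b <- z) (1 - b *: 'X)).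
Proof.
elim: z => [|b z IH] /=; first by rewrite !big_nil => _ n x; rewrite mul1r.
move=> /andP[b1 z1]; rewrite !big_cons; apply: schur_classM; last exact: IH.
move=> [|n] x; first by rewrite /nsq !big_ord0.
by rewrite -subr_ge0 nsq_blaschke_factor mulr_ge0 ?sqr_ge0// subr_ge0 ltW// -norm_lt1_sqr.
Qed.

Lemma snum_nseq0 N : snum (nseq N (0 : R)) = 0.
Proof. by elim: N => [//|N IH] /=; rewrite snum_cons IH scale0r mulr0 addr0. Qed.

Lemma horner_prod_XsubC_eq0 z b : b \in z -> (\prod_(a <- z) ('X - a%:P)).[b] = 0.
Proof. by move=> bz; apply/eqP; rewrite -rootE root_prod_XsubC. Qed.

Lemma coprimep_prod_XsubC z Q : (forall b, b \in z -> Q.[b] != 0) ->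
  coprimep (\prod_(a <- z) ('X - a%:P)) Q.
Proof.
elim: z => [|b z IH] h; first by rewrite big_nil coprime1p.
rewrite big_cons coprimepMl coprimep_sym coprimep_XsubC rootE h ?mem_head//=.
by apply: IH => c cz; rewrite h// inE cz orbT.
Qed.

Lemma unit_normc_inv (a : C) : normc a = 1 -> a^-1 = conjc a.
Proof.
case: a => u v /= h.
have h2 : u ^+ 2 + v ^+ 2 = 1.
  by rewrite -[LHS]sqr_sqrtr ?addr_ge0 ?sqr_ge0// h expr1n.
by rewrite /GRing.inv/= h2 !divr1.
Qed.

(** With [Q(1) = 1] the condition at 1 becomes [P(1) = t], which fixes the multiple of [P0]; only
    [Q] is to be found. Since [t != 0], [P] has exact degree [size z], the number of steps the
    algorithm takes before its last parameter. *)
Lemma vanishing_pair z (t : R) : (0 < size z)%N -> all (fun b => 0 < b < 1) z ->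
  -1 <= t < 1 -> t != 0 ->
  exists s e, [/\ size s = size z, all (fun b => `|b| < 1) s, `|e| <= 1 &
   [/\ forall b, b \in z -> (snum (rcons s e)).[b] = 0,
      (snum (rcons s e)).[1] = t * (sden (rcons s e)).[1] &
      (sden (rcons s e)).[1] != 0]].
Proof.
move=> N0 z1 /andP[tN1 t1] t0.
set N := size z in N0 *.
pose P0 : {poly R} := \prod_(b <- z) ('X - b%:P).
have zb b : b \in z -> 0 < b < 1 by move/(allP z1).
have P01 : P0.[1] != 0.
  rewrite -rootE root_prod_XsubC; apply/negP => /zb; rewrite ltxx andbF//.
have P00 : P0`_0 != 0.
  by rewrite -horner_coef0 -rootE root_prod_XsubC; apply/negP => /zb; rewrite ltxx.
have sP0 : size P0 = N.+1 by rewrite size_prod_XsubC.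
pose P := (t / P0.[1]) *: P0.
have c0 : t / P0.[1] != 0 by rewrite mulf_neq0// invr_eq0.
have sP : size P = N.+1 by rewrite size_scale.
have P1 : P.[1] = t by rewrite hornerZ divfK.
have Pz b : b \in z -> P.[b] = 0.
  by move=> bz; rewrite hornerZ (horner_prod_XsubC_eq0 bz) mulr0.
suff [Q [k [sQ Q1 hPQ [K cop]]]] : exists Q k, [/\ (size Q <= N.+1)%N, Q.[1] = 1,
    Q * revp N Q = P * revp N P + k *: 'X^N & schur_class P Q /\ coprimep P Q].
  have Q0 : Q`_0 != 0.
    apply/eqP => Q0; have := schur_class_coef0 K; rewrite Q0 expr0n/= => h.
    have /eqP : P`_0 ^+ 2 = 0 by apply/le_anti; rewrite h sqr_ge0.
    rewrite sqrf_eq0 coefZ mulf_eq0 (negbTE c0)/=; exact/negP.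
  have [s [e [c [ss s1 e1 cn0 [hP hQ]]]]] := schur_algorithm sP sQ cop K Q0 hPQ.
  have hS1 : (sden (rcons s e)).[1] = c^-1.
    by apply: (mulfI cn0); rewrite -hornerZ -hQ Q1 mulfV.
  exists s, e; split => //; split.
  - move=> b bz; have := Pz b bz; rewrite hP hornerZ => /eqP.
    by rewrite mulf_eq0 (negbTE cn0) => /eqP.
  - by apply: (mulfI cn0); rewrite -hornerZ -hP P1 hS1 mulrCA mulfV// mulr1.
  - by rewrite hS1 invr_eq0.
have copP Q : (forall b, b \in z -> Q.[b] != 0) -> coprimep P Q.
  by move=> h; rewrite coprimepZl// coprimep_prod_XsubC.
have [tE|tn] := eqVneq t (-1).
  (* For [t = -1] the constant [1 - t^2] is 0 and [Q] is explicit: [P/Q] is minus the Blaschke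
     product with zeros [z]. *)
  exists (P0.[1]^-1 *: revp N P0), 0; split.
  - by rewrite (leq_trans (size_scale_leq _ _))// size_revp.
  - by rewrite hornerZ horner_revp1 ?sP0// mulVf.
  - rewrite /P tE mulN1r scale0r addr0 !revpZ revpK ?sP0//.
    by rewrite -!scalerAl -!scalerAr !scalerA mulrNN [P0 * _]mulrC.
  split; last first.
    apply: copP => b bz; rewrite hornerZ mulf_neq0 ?invr_eq0//.
    rewrite revp_prod_XsubC horner_prod prodf_seq_neq0; apply/allP => d dz /=.
    have /andP[b0 b1] := zb b bz; have /andP[d0 d1] := zb d dz.
    by rewrite !hornerE gt_eqF// subr_gt0 mulr_ilt1 ?ltW.
  rewrite /P tE mulN1r scaleNr.
  have zz : all (fun b => `|b| < 1) z.
    by apply/allP => b bz; have /andP[b0 b1] := zb b bz; rewrite gtr0_norm.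
  have := schur_classZ P0.[1]^-1 (schur_class_blaschke zz).
  rewrite -revp_prod_XsubC => K n x; rewrite mulNr.
  have -> : nsq n (- (P0.[1]^-1 *: P0 * x)) = nsq n (P0.[1]^-1 *: P0 * x).
    by apply: eq_bigr => i _; rewrite coefN sqrrN.
  exact: K.
pose k := 1 - t ^+ 2.
have k0 : 0 < k.
  rewrite /k subr_gt0 -norm_lt1_sqr ltr_norml t1 andbT lt_neqAle tN1 andbT eq_sym.
  exact: tn.
pose F := P * revp N P + k *: 'X^N.
have P0n : P`_0 != 0 by rewrite coefZ mulf_neq0.
have srP : size (revp N P) = N.+1.
  apply/anti_leq; rewrite size_revp/= ltnNge; apply/negP => /leq_sizeP/(_ N (leqnn _)).
  by rewrite coef_revp leqnn subnn; exact/eqP.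
have sF : size F = (N + N).+1.
  have h : size (P * revp N P) = (N + N).+1.
    rewrite size_mul ?sP ?srP ?addnS//; first by rewrite -size_poly_gt0 sP.
    by rewrite -size_poly_gt0 srP.
  rewrite size_polyDl h// (leq_ltn_trans (size_scale_leq _ _))// size_polyXn; lia.
have rF : revp (N + N) F = F.
  rewrite revpD revpM ?sP ?srP// revpK ?sP// [revp _ (k *: _)]revpZ revpXn ?leq_addl//
    addnK.
  by rewrite mulrC.
have F1 : F.[1] = 1.
  rewrite hornerD hornerM [(k *: _).[_]]hornerZ hornerXn horner_revp1 ?sP// P1 expr1n
    mulr1 /k; ring.
have [Q [s [c [sQ hQ Q1 cn0 [hc s1]]]]] : exists Q (s : seq C) (c : C),
  [/\ (size Q <= N.+1)%N,
    Q * revp N Q = F, Q.[1] = 1, c != 0 &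
    map_poly toC Q = c *: \prod_(a <- s) (1 - a *: 'X) /\
    all (fun a => normc a < 1) s].
  (* On the unit circle [P*(a) = a^N conj(P(a))], so [F(a) = a^N (|P(a)|^2 + k)], which is nonzero
     because [k > 0]. *)
  apply: fejer_riesz => // a a1; apply/eqP.
  have a0 : a != 0 by apply/eqP => a0; move: a1; rewrite a0 normc0 => /eqP;
    rewrite eq_sym oner_eq0.
  rewrite rmorphD rmorphM/= map_revp hornerD hornerM horner_revp ?size_map_poly ?sP//.
  rewrite unit_normc_inv// [map_poly _ (k *: _)]map_polyZ map_polyXn [(_ *:
    'X^_).[_]]hornerZ hornerXn.
  have -> : (map_poly toC P).[conjc a] = conjc (map_poly toC P).[a].
    rewrite -horner_map/=; congr (_.[_]); apply/polyP => i.
    by rewrite !coef_map/= oppr0.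
  rewrite mulrCA [_ * a ^+ N]mulrC -mulrDr => /eqP;
    rewrite mulf_eq0 expf_eq0 (negbTE a0) andbF/=.
  case: (_.[a]) => u v /eqP [] h _; move: h.
  have := sqr_ge0 u; have := sqr_ge0 v; rewrite !expr2 mulrN opprK; lra.
exists Q, k; split => //; split.
  by apply: (schur_class_outer _ sQ (ltW k0) hQ cn0 hc s1); rewrite sP.
apply: copP => b bz; have /andP[b0 b1] := zb b bz; apply/eqP => Qb.
move: hQ => /(congr1 (fun p => p.[b]));
  rewrite /F hornerD !hornerM [(k *: _).[_]]hornerZ hornerXn Qb Pz// !mul0r add0r =>
  /esym/eqP.
by rewrite mulf_eq0 expf_eq0 !gt_eqF// andbF.
Qed.

End VanishingContrasts.

(** * From contrasts back to coating conductivities *)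

Section Coatings.
Context {R : realType}.
Implicit Types (z : seq R).

Definition contrasts N (sigma : nat -> R) : seq R :=
  mkseq (fun k => contrast sigma k.+1) N.+1.

Lemma contrasts_rcons N (sigma : nat -> R) :
  contrasts N sigma = rcons (mkseq (fun k => contrast sigma k.+1) N) (contrast sigma N.+1).
Proof. by rewrite /contrasts /mkseq -[in iota _ _]addn1 iotaD map_cat cats1. Qed.

Lemma conductivity_last N (s : N.-tuple R) core : conductivity s core N.+1 = core.
Proof. by rewrite /conductivity/= nth_rcons size_tuple ltnn eqxx. Qed.

Lemma conductivity_coat N (s : N.-tuple R) core k : (k < N)%N ->
  conductivity s core k.+1 = nth 0 s k.
Proof. by move=> kN; rewrite /conductivity/= nth_rcons size_tuple kN. Qed.

Lemma contrast_norm_le1 (sigma : nat -> R) k : 0 <= sigma k.-1 -> 0 <= sigma k ->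
  `|contrast sigma k| <= 1.
Proof.
move=> a0 b0; rewrite /contrast; have [->|s0] := eqVneq (sigma k + sigma k.-1) 0.
  by rewrite invr0 mulr0 normr0.
have sp : 0 < sigma k + sigma k.-1 by rewrite lt_neqAle eq_sym s0 addr_ge0.
by rewrite normrM normfV (gtr0_norm sp) ler_pdivrMr// mul1r ler_norml; apply/andP; split;
  lra.
Qed.

(* Conductivity of the k-th layer for the contrasts s and background 1. *)
Definition layered (s : seq R) k : R := \prod_(e <- take k s) ((1 + e) / (1 - e)).

Lemma layeredS s k : (k < size s)%N ->
  layered s k.+1 = layered s k * ((1 + s`_k) / (1 - s`_k)).
Proof. by move=> ks; rewrite /layered (take_nth 0 ks) big_rcons. Qed.

Lemma layered_gt0 s k : all (fun e => `|e| < 1) s -> 0 < layered s k.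
Proof.
move=> s1; rewrite /layered; have : all (fun e => `|e| < 1) (take k s).
  by apply/allP => e /mem_take; exact: (allP s1).
elim: (take k s) => [|e t IH] /=; first by rewrite big_nil.
move=> /andP[+ t1]; rewrite big_cons ltr_norml => /andP[? ?].
by rewrite mulr_gt0 ?IH// divr_gt0//; lra.
Qed.

(** Any parameters of modulus below 1 are the contrasts of positive coatings, so only the last
    contrast, towards the prescribed core, is a constraint; the value of [P/Q] at 1 settles it. *)
Lemma coating_exists N z (core : R) : size z = N -> (0 < N)%N ->
  all (fun b => 0 < b < 1) z -> 0 <= core ->
  exists s : N.-tuple R, [/\ forall k, (k <= N)%N -> 0 < conductivity s core k,
    all (fun e => `|e| < 1) (mkseq (fun k => contrast (conductivity s core) k.+1) N) &
    forall b, b \in z -> (snum (contrasts N (conductivity s core))).[b] = 0].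
Proof.
move=> sz N0 z1 c0.
(* The condition on [e] says that it is the contrast between [core] and the last coating. *)
suff [s [e [ss s1 hcore hz]]] : exists s e, [/\ size s = N, all (fun b => `|b| < 1) s,
    (e + 1) * layered s N = core * (1 - e) /\ core + layered s N != 0 &
    forall b : R, b \in z -> (snum (rcons s e)).[b] = 0].
  have sL : size [seq layered s k.+1 | k <- iota 0 N] == N by rewrite size_map size_iota.
  pose t := Tuple sL.
  have tE k : (k <= N)%N -> conductivity t core k = layered s k.
    case: k => [|k] kN; first by rewrite /conductivity /layered take0 big_nil.
    by rewrite conductivity_coat// (nth_map 0%N) ?size_iota// nth_iota.
  have cE k : (k < N)%N -> contrast (conductivity t core) k.+1 = s`_k.
    move=> kN; rewrite /contrast !tE//=; last exact: ltnW.
    have := layered_gt0 k s1; rewrite layeredS ?ss// => l0.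
    have := allP s1 _ (mem_nth 0 (_ : k < size s)%N); rewrite ss => /(_ kN).
    rewrite ltr_norml => /andP[h1 h2].
    field; rewrite !gt_eqF//; try lra.
  have mE : mkseq (fun k => contrast (conductivity t core) k.+1) N = s.
    apply: (@eq_from_nth _ 0); rewrite size_mkseq ?ss// => k kN.
    by rewrite nth_mkseq// cE.
  exists t; split.
  - by move=> k kN; rewrite tE// layered_gt0.
  - by rewrite mE.
  move=> b bz; rewrite contrasts_rcons mE.
  have -> : contrast (conductivity t core) N.+1 = e.
    rewrite /contrast conductivity_last tE//.
    case: hcore => h1 h2; apply: (mulIf h2); rewrite divfK//; lra.
  exact: hz.
(* Core equal to background: all contrasts are taken to be 0 and the numerator is the zero
   polynomial. *)
have [->|cn1] := eqVneq core 1.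
  exists (nseq N 0), 0; split.
  - exact: size_nseq.
  - by rewrite all_nseq normr0 ltr01 orbT.
  - have -> : layered (nseq N 0) N = 1.
      rewrite /layered take_oversize ?size_nseq// big_nseq.
      by elim: (N) => //= n ->; rewrite addr0 subr0 divr1 mulr1.
    by split; [ring|rewrite gt_eqF].
  - by move=> b _; rewrite -cats1 -(nseqD N 1) snum_nseq0 horner0.
have c1 : core + 1 != 0 by rewrite gt_eqF// ltr_wpDl.
pose t := (core - 1) / (core + 1).
have [||||s [e [ss s1 e1 [hz h1 h2]]]] := @vanishing_pair R z t.
- by rewrite sz.
- exact: z1.
- rewrite /t ler_pdivlMr ?ltr_pdivrMr ?ltr_wpDl//; apply/andP; split; lra.
- by rewrite mulf_neq0 ?invr_eq0 ?subr_eq0.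
have [g1 g2] := horner1_schur (rcons s e).
exists s, e; rewrite sz in ss; split => //.
have lE : layered s N * \prod_(a <- s) (1 - a) = \prod_(a <- s) (1 + a).
  rewrite /layered take_oversize ?ss// -big_split/=; apply: eq_big_seq => a /(allP s1).
  by rewrite ltr_norml => /andP[? ?]; rewrite divfK// gt_eqF// subr_gt0.
move: g1 g2; rewrite !big_rcons/= h1 -lE.
set p := \prod_(a <- s) (1 - a); set q := (sden _).[1] in h2 *; set l := layered s N.
move=> g1 g2.
have l0 : 0 < l by apply: layered_gt0.
have p0 : p != 0.
  rewrite prodf_seq_neq0; apply/allP => a /(allP s1) /=.
  by rewrite ltr_norml => /andP[? ?]; rewrite gt_eqF// subr_gt0.
have tE : t * (core + 1) = core - 1 by rewrite divfK.
split; last by rewrite gt_eqF// ltr_wpDl.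
have h3 : (core + 1) * (q + t * q) = core * ((core + 1) * (q - t * q)).
  have -> : (core + 1) * (q + t * q) = (core + 1 + t * (core + 1)) * q by ring.
  have -> : (core + 1) * (q - t * q) = (core + 1 - t * (core + 1)) * q by ring.
  rewrite tE; ring.
apply: (mulIf p0); apply: (mulfI c1); move: h3; rewrite g1 g2.
move=> h3; rewrite [LHS](_ : _ = (core + 1) * (l * p * (1 + e))); last by ring.
by rewrite h3; ring.
Qed.

(** Here [t] is the reference coating, with contrasts of modulus below 1, whereas [s] is merely
    admissible, so its contrasts could a priori reach modulus 1. *)
Lemma coating_unique N z (s t : N.-tuple R) : size z = N -> uniq z ->
  admissible N (conductivity s 0) -> admissible N (conductivity t 0) ->
  all (fun e => `|e| < 1) (mkseq (fun k => contrast (conductivity t 0) k.+1) N) ->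
  (forall b, b \in z -> (snum (contrasts N (conductivity s 0))).[b] = 0) ->
  (forall b, b \in z -> (snum (contrasts N (conductivity t 0))).[b] = 0) -> s = t.
Proof.
move=> sz uz [s0 sn0] [t0 tn0] t1 hs ht.
have lastN1 (u : N.-tuple R) : admissible N (conductivity u 0) ->
    contrast (conductivity u 0) N.+1 = -1.
  move=> [_ /(_ N.+1)]; rewrite leqnn /contrast conductivity_last/= addr0 !add0r => h.
  by rewrite mulNr divff// h.
have numE (e : seq R) : size e = N ->
    (forall b, b \in z -> (snum (rcons e (-1))).[b] = 0) ->
    snum (rcons e (-1)) = - \prod_(a <- z) ('X - a%:P).
  move=> se h.
  have lc := coef_last_snum e (-1); rewrite se in lc.
  have [le _] := size_schur (rcons e (-1)); rewrite size_rcons se in le.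
  have sN : size (snum (rcons e (-1))) = N.+1.
    apply/anti_leq; rewrite le ltnNge; apply/negP => /leq_sizeP/(_ N (leqnn _)).
    by rewrite lc => /eqP; rewrite oppr_eq0 oner_eq0.
  have rz : all (root (snum (rcons e (-1)))) z by apply/allP => b bz; rewrite rootE h.
  have := @all_roots_prod_XsubC _ (snum (rcons e (-1))) z.
  rewrite sN sz uniq_rootsE => /(_ erefl rz uz) ->.
  by rewrite lead_coefE sN/= lc scaleN1r.
rewrite !contrasts_rcons !lastN1// in hs ht.
have hse := size_mkseq (fun k => contrast (conductivity s 0) k.+1) N.
have hte := size_mkseq (fun k => contrast (conductivity t 0) k.+1) N.
have eP := etrans (numE _ hse hs) (esym (numE _ hte ht)).
have eQ := schur_rconsN1 (mkseq (fun k => contrast (conductivity s 0) k.+1) N).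
rewrite eP hse -[X in revp X _]hte -schur_rconsN1 in eQ.
have /rcons_inj[eC] := schur_inj (etrans hse (esym hte)) t1 eP eQ.
have step k : (k < N)%N -> contrast (conductivity s 0) k.+1 = contrast (conductivity t 0)
  k.+1.
  by move=> kN; move: eC => /(congr1 (fun u => nth 0 u k)); rewrite !nth_mkseq.
(* Equal contrasts and equal outer conductivities give [(1 - e) (x - y) = 0] for the inner ones, and
   [e < 1]. *)
have H k : (k <= N)%N -> conductivity s 0 k = conductivity t 0 k.
  elim: k => [//|k IH] kN.
  have memk : contrast (conductivity t 0) k.+1 \in
      mkseq (fun k => contrast (conductivity t 0) k.+1) N.
    by apply/mapP; exists k => //; rewrite mem_iota.
  have := allP t1 _ memk; have := step k kN.
  have := sn0 k.+1 (ltnW kN); have := tn0 k.+1 (ltnW kN).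
  rewrite /contrast/= -IH ?(ltnW kN)//.
  move: (conductivity s 0 k.+1) (conductivity t 0 k.+1) (conductivity s 0 k) => x y w.
  rewrite addrC => h1; rewrite addrC => h2 hxy; rewrite ltr_norml => /andP[_ e1].
  have hx : x - w = (y - w) / (y + w) * (x + w) by rewrite -hxy divfK.
  have hy : y - w = (y - w) / (y + w) * (y + w) by rewrite divfK.
  have : (1 - (y - w) / (y + w)) * (x - y) = 0 by lra.
  by move=> /eqP; rewrite mulf_eq0 gt_eqF ?subr_gt0// subr_eq0 => /eqP.
apply/val_inj; apply: (@eq_from_nth _ 0); rewrite !size_tuple// => k kN.
by rewrite -(conductivity_coat s 0 kN) -(conductivity_coat t 0 kN) H.
Qed.

End Coatings.

(** * Linear system of a Fourier mode *)

Section LayerSystem.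
Context {R : realFieldType}.
Variables (N : nat) (eta x : nat -> R) (w C : R).
Hypothesis xS : forall k, x k.+1 = w * x k.
Hypothesis x0 : forall k, x k != 0.

(* Here [x k] stands for r_k^(2n). *)
Definition coupling j k : R := if (k < j)%N then - (x j / x k) else 1.

Definition layer_system (b : nat -> R) := forall j, (1 <= j <= N.+1)%N ->
  b j - eta j * (\sum_(1 <= k < N.+2 | k != j) coupling j k * b k)
  = eta j * (C * x j).

Let tail j := mkseq (fun i => eta (j + i)) (N.+2 - j).
Let P j := (snum (tail j)).[w].
Let Q j := (sden (tail j)).[w].

Let tailS j : (j < N.+2)%N -> tail j = eta j :: tail j.+1.
Proof.
move=> jN; rewrite /tail subnS -[(N.+2 - j)%N]prednK ?subn_gt0// /mkseq/= addn0.
congr (_ :: _); rewrite -[1%N]addn0 iotaDl -map_comp; apply: eq_map => i /=.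
by rewrite addnA addn1.
Qed.

Let tail_last : tail N.+2 = [::].
Proof. by rewrite /tail subnn. Qed.

Let PS j : (j < N.+2)%N -> P j = eta j * Q j.+1 + w * P j.+1.
Proof. by move=> jN; rewrite /P tailS// snum_cons !(hornerD, hornerZ, hornerM,
  hornerX). Qed.

Let QS j : (j < N.+2)%N -> Q j = Q j.+1 + eta j * (w * P j.+1).
Proof. by move=> jN; rewrite /Q tailS// sden_cons !(hornerD, hornerZ, hornerM,
  hornerX). Qed.

Let Plast : P N.+2 = 0.
Proof. by rewrite /P tail_last /snum/= horner0. Qed.

(** Inner interfaces act with weight 1 and outer ones with a weight that separates into [x j] and
    [x k], so two running sums carry the whole system. *)
Lemma coupling_sum (b : nat -> R) j : (1 <= j <= N.+1)%N ->
  \sum_(1 <= k < N.+2 | k != j) coupling j k * b k =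
  \sum_(j.+1 <= k < N.+2) b k - x j * \sum_(1 <= k < j) b k / x k.
Proof.
move=> /andP[j1 jN]; rewrite (big_cat_nat (n := j))//=; last exact: leqW.
rewrite [X in _ + X]big_ltn_cond//= eqxx/= addrC; congr (_ + _).
  rewrite big_nat_cond [RHS]big_nat_cond; apply: eq_big => k.
    by case: ltnP => //= jk; rewrite (gtn_eqF jk) andbT.
  by move=> /andP[/andP[jk _] _]; rewrite /coupling ltnNge (ltnW jk) mul1r.
rewrite mulr_sumr -sumrN big_nat_cond [RHS]big_nat_cond; apply: eq_big => k.
  by case: (ltnP k j) => kj; rewrite ?andbF//= (ltn_eqF kj).
move=> /andP[/andP[_ kj] _]; rewrite /coupling kj mulNr; congr (- _).
by rewrite mulrAC -mulrA.
Qed.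

(** Elimination from the core outwards. [T j] is the moment of the interfaces from [j] inwards, and
    [A j] the amplitude reaching them: the source [C] reduced by the outer interfaces. Their ratio
    is [x j] times [P j / Q j], the response of the inner block. *)
Lemma layer_system_moment b : layer_system b ->
  (sden (mkseq (fun i => eta i.+1) N.+1)).[w] * (\sum_(1 <= k < N.+2) b k) =
  (snum (mkseq (fun i => eta i.+1) N.+1)).[w] * (C * x 1%N).
Proof.
move=> hb; rewrite -[mkseq _ _]/(tail 1).
pose T j := \sum_(j <= k < N.+2) b k.
pose A j := C - \sum_(1 <= k < j) b k / x k.
suff H m : (m <= N.+1)%N -> Q (N.+2 - m) * T (N.+2 - m)%N =
    P (N.+2 - m) * (x (N.+2 - m)%N * A (N.+2 - m)%N).
  have := H N.+1 (leqnn _); have -> : (N.+2 - N.+1 = 1)%N by lia.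
  by rewrite /Q /P /A /T [\sum_(1 <= k < 1) _]big_geq// subr0 [x _ * _]mulrC.
elim: m => [|m IH] mN; first by rewrite subn0 /T big_geq// Plast mul0r mulr0.
set j := (N.+2 - m.+1)%N.
have jE : (N.+2 - m = j.+1)%N by rewrite /j; lia.
have j1 : (1 <= j <= N.+1)%N by rewrite /j; lia.
move: (IH (ltnW mN)); rewrite jE => {IH}.
have := hb j j1; rewrite coupling_sum// -/(T j.+1).
have jN : (j < N.+2)%N by lia.
have -> : T j = b j + T j.+1 by rewrite /T big_ltn.
have -> : A j.+1 = A j - b j / x j by rewrite /A big_nat_recr//=; [ring|lia].
rewrite (PS jN) (QS jN) xS.
have -> : w * x j * (A j - b j / x j) = w * (x j * A j - b j) by field; exact: x0.
have -> : x j * \sum_(1 <= k < j) b k / x k = x j * C - x j * A j by rewrite /A; ring.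
move: (P _) (Q _) (T _) (A _) (b j) (eta j) (x j) => p q t a c e y hc ht.
have {}hc : c = e * (t + y * a) by lra.
rewrite {}hc in ht *.
move: ht => /eqP; rewrite -subr_eq0 => /eqP ht.
apply/eqP; rewrite -subr_eq0; apply/eqP.
(* With [b j] eliminated, the relation at [j] is [1 + e] times the one at [j.+1]. *)
have -> : (q + e * (w * p)) * (e * (t + y * a) + t) - (e * q + w * p) * (y * a) =
  (1 + e) * (q * t - p * (w * (y * a - e * (t + y * a)))) + 0 by ring.
by rewrite addr0 ht mulr0.
Qed.

Lemma layer_system_solvable : 0 < w < 1 ->
  (forall j, (1 <= j <= N.+1)%N -> `|eta j| <= 1) -> exists b, layer_system b.
Proof.
move=> w01 eta1.
have Q0 j : (1 <= j)%N -> Q j != 0.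
  move=> j1; have h : {in tail j, forall e, `|e| <= 1}.
    by apply/allP/(all_nthP 0) => i; rewrite size_mkseq => iN;
      rewrite nth_mkseq// eta1//; lia.
  by have [/gt_eqF->] := schur_bound h w01.
(* [al] solves for the amplitudes [A j] from the outside inwards, starting with [C] at index 1. The
   factor comes from combining row [k] of the system with the known response of the interfaces
   inside [k]; then [T] and its differences [b] follow. *)
pose al := fix al k := if k is k'.+1 then
   (if k' is 0 then C else (1 - eta k') * (Q k'.+1 / Q k') * al k') else 0.
have alS k : (1 <= k)%N -> al k.+1 = (1 - eta k) * (Q k.+1 / Q k) * al k by case: k.
pose T j := x j * P j * al j / Q j.
pose b j := T j - T j.+1.
have sT j : (1 <= j <= N.+1)%N -> \sum_(j.+1 <= k < N.+2) b k = T j.+1.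
  move=> /andP[_ jN]; rewrite -[LHS]opprK -sumrN.
  under eq_bigr do rewrite /b opprB.
  by rewrite telescope_sumr// opprB {2}/T Plast mulr0 !mul0r subr0.
have hb j : (1 <= j <= N.+1)%N -> b j = x j * (al j - al j.+1).
  move=> /andP[j1 jN]; rewrite /b /T alS// xS.
  have q1 := Q0 j j1; have q2 := Q0 j.+1 isT.
  rewrite (PS (j := j))//; move: q1; rewrite (QS (j := j))// => q1.
  by field; rewrite q1 q2.
have sA j : (1 <= j <= N.+1)%N -> \sum_(1 <= k < j) b k / x k = C - al j.
  move=> /andP[j1 jN].
  rewrite (eq_big_nat _ _ (F2 := fun k => - (al k.+1 - al k))); last first.
    move=> k /andP[k1 kj]; rewrite hb ?k1 ?(leq_trans (ltnW kj))//.
    by rewrite mulrAC mulfV// mul1r opprB.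
  by rewrite sumrN telescope_sumr// opprB.
exists b => j j1; rewrite coupling_sum// sT// sA// hb//.
move: j1 => /andP[j1 jN]; rewrite /T alS// xS.
have q1 := Q0 j j1; have q2 := Q0 j.+1 isT.
move: q1; rewrite (QS (j := j))// => q1; field.
by rewrite q1 q2.
Qed.

End LayerSystem.

(** * Fourier analysis on the circle *)

Section FourierModes.
Context {R : realType}.
Local Notation mu := (@lebesgue_measure R).
Local Notation I := (`[0, 2 * pi]%classic : set R).
Implicit Types (f g h : R -> R) (n m : nat) (q t s : R).

Lemma twopi_gt0 : 0 < 2 * pi :> R.
Proof. by rewrite mulr_gt0// pi_gt0. Qed.

Definition I_integrable f := mu.-integrable I (EFin \o f).

Lemma measurable_I : measurable I.
Proof. exact: measurable_itv. Qed.

Lemma continuous_I_integrable f : continuous f -> I_integrable f.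
Proof.
move=> cf; apply: continuous_compact_integrable; first exact: segment_compact.
exact: continuous_subspaceT.
Qed.

Lemma FTC_I (F f : R -> R) : (forall x : R, is_derive x (1 : R) F (f x)) -> continuous f ->
  \int[mu]_(x in I) f x = F (2 * pi) - F 0.
Proof.
move=> dF cf.
have cF : continuous F.
  move=> x; apply: differentiable_continuous; apply/derivable1_diffP.
  by have [] := dF x.
rewrite /Rintegral (@continuous_FTC2 _ f F)//.
- exact: twopi_gt0.
- exact: continuous_subspaceT.
- split.
  + by move=> x _; have [] := dF x.
  + exact/cvg_at_right_filter/cF.
  + exact/cvg_at_left_filter/cF.
- by move=> x _; rewrite derive1E; have [] := dF x.
Qed.

Lemma cos_nat2pi n : cos (n%:R * (2 * pi)) = 1 :> R.
Proof.
have h := periodicn (@cosD2pi R) n 0; rewrite add0r cos0 in h.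
by rewrite -[RHS]h; congr cos; rewrite -[RHS]mulr_natl -[pi *+ 2]mulr_natl.
Qed.

Lemma sin_nat2pi n : sin (n%:R * (2 * pi)) = 0 :> R.
Proof.
have h := periodicn (@sinD2pi R) n 0; rewrite add0r sin0 in h.
by rewrite -[RHS]h; congr sin; rewrite -[RHS]mulr_natl -[pi *+ 2]mulr_natl.
Qed.

Lemma continuous_cosM c : continuous (fun t : R => cos (c * t)).
Proof.
move=> t; apply: (@continuous_comp _ _ _ (fun t => c * t) cos); last exact: continuous_cos.
by apply: cvgM; [exact: cvg_cst|exact: cvg_id].
Qed.

Lemma continuous_sinM c : continuous (fun t : R => sin (c * t)).
Proof.
move=> t; apply: (@continuous_comp _ _ _ (fun t => c * t) sin); last exact: continuous_sin.
by apply: cvgM; [exact: cvg_cst|exact: cvg_id].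
Qed.

Lemma int_cos n : (0 < n)%N -> \int[mu]_(t in I) cos (n%:R * t) = 0 :> R.
Proof.
move=> n0; have nn0 : n%:R != 0 :> R by rewrite pnatr_eq0 -lt0n.
have dF (x : R) : is_derive x (1 : R) (fun t => n%:R^-1 * sin (n%:R * t)) (cos (n%:R * x)).
  by apply: is_derive_eq; rewrite /GRing.scale/= ; field.
by rewrite (FTC_I dF (@continuous_cosM _)) sin_nat2pi !mulr0 sin0 mulr0 subrr.
Qed.

Lemma int_sin n : \int[mu]_(t in I) sin (n%:R * t) = 0 :> R.
Proof.
have [->|n0] := posnP n.
  by under eq_Rintegral do rewrite mul0r sin0; rewrite Rintegral_cst ?mul0r//;
    exact: measurable_I.
have nn0 : n%:R != 0 :> R by rewrite pnatr_eq0 -lt0n.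
have dF (x : R) : is_derive x (1 : R) (fun t =>
  - n%:R^-1 * cos (n%:R * t)) (sin (n%:R * x)).
  by apply: is_derive_eq; rewrite /GRing.scale/= ; field.
by rewrite (FTC_I dF (@continuous_sinM _)) cos_nat2pi mulr0 cos0 subrr.
Qed.


Lemma I_integrableD f g : I_integrable f -> I_integrable g ->
  I_integrable (fun t => f t + g t).
Proof.
move=> fi gi; rewrite /I_integrable.
have -> : EFin \o (fun t => f t + g t) = ((EFin \o f) \+ (EFin \o g))%E by [].
by apply: integrableD => //; exact: measurable_I.
Qed.

Lemma I_integrableZ c f : I_integrable f -> I_integrable (fun t => c * f t).
Proof.
move=> fi; rewrite /I_integrable.
have -> : EFin \o (fun t => c * f t) = (fun t => c%:E * (EFin \o f) t)%E by [].
by apply: integrableZl => //; exact: measurable_I.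
Qed.

Lemma I_integrableB f g : I_integrable f -> I_integrable g ->
  I_integrable (fun t => f t - g t).
Proof.
move=> fi gi; have -> : (fun t => f t - g t) = (fun t => f t + -1 * g t).
  by apply/funext => t; rewrite mulN1r.
by apply: I_integrableD => //; exact: I_integrableZ.
Qed.

Lemma I_integrable_cst c : I_integrable (fun=> c).
Proof. by apply: continuous_I_integrable => x; exact: cvg_cst. Qed.

Lemma I_integrable_measurable f : I_integrable f -> measurable_fun I f.
Proof. by move=> /integrableP[/measurable_EFinP]. Qed.

Lemma I_integrable_norm f : I_integrable f -> I_integrable (fun t => `|f t|).
Proof.
by move=> fi; exact: (integrable_norm fi).
Qed.

Lemma I_integrable_le f g : measurable_fun I f -> I_integrable g ->
  (forall t, I t -> `|f t| <= g t) -> I_integrable f.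
Proof.
move=> mf gi fg; apply: (le_integrable _ _ _ gi).
- exact: measurable_I.
- exact/measurable_EFinP.
- by move=> t It; rewrite /= lee_fin (le_trans (fg t It))// ler_norm.
Qed.

Lemma I_integrableM_bounded h g M : measurable_fun I h ->
  (forall t, I t -> `|h t| <= M) -> I_integrable g ->
  I_integrable (fun t => h t * g t).
Proof.
move=> mh hM gi; apply: (@I_integrable_le _ (fun t => M * `|g t|)).
- by apply: measurable_funM => //; exact: I_integrable_measurable.
- exact/I_integrableZ/I_integrable_norm.
- by move=> t It; rewrite normrM ler_wpM2r// hM.
Qed.

Lemma continuous_I_bounded h : continuous h -> exists M, forall t, I t -> `|h t| <= M.
Proof.
move=> ch; have [|c _ hc] := @EVT_max R (fun t => `|h t|) 0 (2 * pi) (ltW twopi_gt0).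
  by apply: continuous_subspaceT => x; apply: cvg_norm; exact: ch.
by exists `|h c| => t It; apply: hc.
Qed.

Lemma continuous_I_measurable h : continuous h -> measurable_fun I h.
Proof. by move=> ch; apply: measurable_funTS; exact: continuous_measurable_fun. Qed.

Lemma I_integrableM h g : continuous h -> I_integrable g ->
  I_integrable (fun t => h t * g t).
Proof.
move=> ch gi; have [M hM] := continuous_I_bounded ch.
by apply: I_integrableM_bounded hM gi; exact: continuous_I_measurable.
Qed.

Definition I_int f : R := \int[mu]_(t in I) f t.

Lemma I_intD f g : I_integrable f -> I_integrable g ->
  I_int (fun t => f t + g t) = I_int f + I_int g.
Proof. by move=> fi gi; apply: RintegralD => //; exact: measurable_I. Qed.

Lemma I_intB f g : I_integrable f -> I_integrable g ->
  I_int (fun t => f t - g t) = I_int f - I_int g.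
Proof. by move=> fi gi; apply: RintegralB => //; exact: measurable_I. Qed.

Lemma I_intZ c f : I_integrable f -> I_int (fun t => c * f t) = c * I_int f.
Proof. by move=> fi; apply: RintegralZl => //; exact: measurable_I. Qed.

Lemma I_int_cst c : I_int (fun=> c) = 2 * pi * c.
Proof.
rewrite /I_int Rintegral_cst; last exact: measurable_I.
have muI : mu I = (2 * pi)%:E.
  by have := @lebesgue_measure_itv R `[0, 2 * pi]; rewrite /= lte_fin twopi_gt0 oppr0 adde0.
by rewrite [X in _ * fine X]muI mulrC.
Qed.

Lemma I_int_le f g : I_integrable f -> I_integrable g ->
  (forall t, I t -> f t <= g t) -> I_int f <= I_int g.
Proof. by move=> fi gi fg; apply: le_Rintegral => //; exact: measurable_I. Qed.

Lemma I_int_norm_le f g : I_integrable f -> I_integrable g ->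
  (forall t, I t -> `|f t| <= g t) -> `|I_int f| <= I_int g.
Proof.
move=> fi gi fg; apply: (@le_trans _ _ (I_int (fun t => `|f t|))).
  by apply: le_normr_Rintegral => //; exact: measurable_I.
by apply: I_int_le => //; exact: I_integrable_norm.
Qed.

Lemma eq_I_int f g : (forall t, I t -> f t = g t) -> I_int f = I_int g.
Proof. by move=> fg; apply: eq_Rintegral => t /set_mem; exact: fg. Qed.

Lemma I_integrable_sum m (F : nat -> R -> R) : (forall k, I_integrable (F k)) ->
  I_integrable (fun t => \sum_(k < m) F k t).
Proof.
move=> Fi; elim: m => [|m IH].
  by under eq_fun do rewrite big_ord0; exact: I_integrable_cst.
by under eq_fun do rewrite big_ord_recr/=; exact: I_integrableD.
Qed.

Lemma I_int_sum m (F : nat -> R -> R) : (forall k, I_integrable (F k)) ->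
  I_int (fun t => \sum_(k < m) F k t) = \sum_(k < m) I_int (F k).
Proof.
move=> Fi; elim: m => [|m IH].
  by under eq_fun do rewrite big_ord0; rewrite I_int_cst mulr0 big_ord0.
under eq_fun do rewrite big_ord_recr/=.
by rewrite I_intD// ?big_ord_recr/= ?IH//; exact: I_integrable_sum.
Qed.

Lemma I_int_coscos m n : (0 < n)%N ->
  I_int (fun t => cos (m%:R * t) * cos (n%:R * t)) = if m == n then pi else 0.
Proof.
have H d k : (0 < k)%N -> I_int (fun t => cos ((k + d)%:R * t) * cos (k%:R * t)) =
    if d == 0 then pi else 0.
  move=> k0.
  have -> : (fun t : R => cos ((k + d)%:R * t) * cos (k%:R * t)) =
      (fun t => 2^-1 * (cos ((k + d + k)%:R * t) + cos (d%:R * t))).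
    apply/funext => t.
    have -> : (k + d + k)%:R * t = (k + d)%:R * t + k%:R * t by rewrite natrD mulrDl.
    have -> : d%:R * t = (k + d)%:R * t - k%:R * t by rewrite natrD; ring.
    by rewrite cosD cosB; field.
  rewrite I_intZ; last by apply: I_integrableD; apply: continuous_I_integrable;
    exact: continuous_cosM.
  rewrite I_intD; [|apply: continuous_I_integrable; exact: continuous_cosM..].
  rewrite [X in _ * (X + _)]int_cos ?addn_gt0 ?k0// add0r.
  have [->|d0] := eqVneq d 0%N.
    have -> : (fun t : R => cos (0%:R * t)) = (fun=> 1).
      by apply/funext => t; rewrite mul0r cos0.
    by rewrite I_int_cst; field.
  by rewrite [X in _ * X]int_cos ?mulr0// lt0n.
move=> n0; case: (leqP n m) => [nm|mn].
  by have := H (m - n)%N n n0; rewrite subnKC// => ->;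
    rewrite subn_eq0 [in RHS]eqn_leq nm andbT.
have [->|m0] := posnP m.
  rewrite ltn_eqF//.
  have -> : (fun t : R => cos (0%:R * t) * cos (n%:R * t)) = (fun t => cos (n%:R * t)).
    by apply/funext => t; rewrite mul0r cos0 mul1r.
  exact: int_cos.
have -> : (fun t : R => cos (m%:R * t) * cos (n%:R * t)) =
   (fun t => cos (n%:R * t) * cos (m%:R * t)).
  by apply/funext => t; rewrite mulrC.
have := H (n - m)%N m m0; rewrite subnKC ?(ltnW mn)// => ->.
by rewrite subn_eq0 leqNgt mn (ltn_eqF mn).
Qed.

Lemma I_int_sincos m n : I_int (fun t => sin (m%:R * t) * cos (n%:R * t)) = 0.
Proof.
have I_int_sinB k l : I_int (fun t => sin ((k%:R - l%:R) * t)) = 0.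
  have [lk|/ltnW kl] := leqP l k.
    by under eq_fun do rewrite -natrB//; exact: int_sin.
  have -> : (fun t : R => sin ((k%:R - l%:R) * t)) = (fun t => -1 * sin ((l - k)%:R * t)).
    apply/funext => t; have -> : (k%:R - l%:R) * t = - ((l - k)%:R * t) by rewrite
      natrB//; ring.
    by rewrite sinN mulN1r.
  rewrite I_intZ; first by rewrite [X in _ * X]int_sin mulr0.
  by apply: continuous_I_integrable; exact: continuous_sinM.
have -> : (fun t : R => sin (m%:R * t) * cos (n%:R * t)) =
    (fun t => 2^-1 * (sin ((m + n)%:R * t) + sin ((m%:R - n%:R) * t))).
  by apply/funext => t; rewrite natrD mulrDl mulrBl sinD sinB; field.
rewrite I_intZ; last by apply: I_integrableD; apply: continuous_I_integrable;
  exact: continuous_sinM.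
rewrite I_intD; [|apply: continuous_I_integrable; exact: continuous_sinM..].
by rewrite [X in _ * (X + _)]int_sin I_int_sinB addr0 mulr0.
Qed.

(* Real part of 1 / (1 - q e^(it)), i.e. the sum of the q^k cos (k t). *)
Definition kerK q t : R := (1 - q * cos t) / (1 - 2 * q * cos t + q ^+ 2).

Lemma kerK_den q t : 0 <= q -> (1 - q) ^+ 2 <= 1 - 2 * q * cos t + q ^+ 2.
Proof.
move=> q0; have := cos_le1 t => c1.
have : 0 <= q * (1 - cos t) by rewrite mulr_ge0// subr_ge0.
by rewrite sqrrB expr1n mul1r; lra.
Qed.

Lemma kerK_den_gt0 q t : 0 <= q < 1 -> 0 < 1 - 2 * q * cos t + q ^+ 2.
Proof.
move=> /andP[q0 q1]; apply: lt_le_trans (kerK_den t q0).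
by rewrite exprn_gt0// subr_gt0.
Qed.

(** The real part of the finite geometric sum in [q e^(it)], with its exact remainder. *)
Lemma kerK_expand q t m : 0 <= q < 1 -> kerK q t =
  \sum_(k < m) q ^+ k * cos (k%:R * t) +
  q ^+ m * ((cos (m%:R * t) - q * cos (m%:R * t - t)) / (1 - 2 * q * cos t + q ^+ 2)).
Proof.
move=> q01; have D0 := lt0r_neq0 (kerK_den_gt0 t q01).
elim: m => [|m IH].
  by rewrite big_ord0 add0r expr0 mul1r mul0r cos0 sub0r cosN.
rewrite IH big_ord_recr/= -[RHS]addrA; congr (_ + _).
rewrite (_ : m.+1%:R * t - t = m%:R * t); last by rewrite -natr1; ring.
rewrite (_ : m.+1%:R * t = m%:R * t + t); last by rewrite -natr1; ring.
by rewrite [q ^+ m.+1]exprS cosB cosD; field.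
Qed.

Lemma kerK_tail q t m : 0 <= q < 1 ->
  `|kerK q t - \sum_(k < m) q ^+ k * cos (k%:R * t)| <= 2 / (1 - q) ^+ 2 * q ^+ m.
Proof.
move=> q01; rewrite (kerK_expand t m q01) addrC addKr.
have /andP[q0 q1] := q01; rewrite normrM ger0_norm ?exprn_ge0// mulrC ler_wpM2r
  ?exprn_ge0//.
rewrite normrM normfV (gtr0_norm (kerK_den_gt0 t q01)).
apply: ler_pM => //; first by rewrite invr_ge0 ltW// kerK_den_gt0.
  have c1 := cos_max (m%:R * t); have c2 := cos_max (m%:R * t - t).
  rewrite (le_trans (ler_normB _ _))// normrM (ger0_norm q0).
  have : q * `|cos (m%:R * t - t)| <= 1 by rewrite mulr_ile1// ltW.
  lra.
by rewrite lef_pV2 ?posrE ?kerK_den_gt0 ?kerK_den// exprn_gt0// subr_gt0.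
Qed.

Lemma continuous_kerK q t : 0 <= q < 1 -> continuous (fun s => kerK q (t - s)).
Proof.
move=> q01 s.
have cc : cos (t - u) @[u --> s] --> cos (t - s).
  apply: (@continuous_comp _ _ _ (fun u => t - u) cos); last exact: continuous_cos.
  by apply: cvgB; [exact: cvg_cst|exact: cvg_id].
apply: cvgM.
  by apply: cvgB; [exact: cvg_cst|apply: cvgM => //; exact: cvg_cst].
apply: cvgV; first exact: lt0r_neq0 (kerK_den_gt0 _ q01).
apply: cvgD; last exact: cvg_cst.
by apply: cvgB; [exact: cvg_cst|apply: cvgM => //; exact: cvg_cst].
Qed.

Definition conv q g t : R := I_int (fun s => kerK q (t - s) * g s).

Definition conv_sum q g m t : R := \sum_(k < m) q ^+ k *
  (cos (k%:R * t) * I_int (fun s => cos (k%:R * s) * g s) +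
   sin (k%:R * t) * I_int (fun s => sin (k%:R * s) * g s)).

Lemma I_integrable_cosM n g : I_integrable g -> I_integrable (fun s =>
  cos (n%:R * s) * g s).
Proof. by apply: I_integrableM; exact: continuous_cosM. Qed.

Lemma I_integrable_sinM n g : I_integrable g -> I_integrable (fun s =>
  sin (n%:R * s) * g s).
Proof. by apply: I_integrableM; exact: continuous_sinM. Qed.

Lemma conv_sumE q g m t : I_integrable g ->
  conv_sum q g m t = I_int (fun s => (\sum_(k < m) q ^+ k * cos (k%:R * (t - s))) * g s).
Proof.
move=> gi.
pose F k s := q ^+ k * (cos (k%:R * t) * (cos (k%:R * s) * g s) +
  sin (k%:R * t) * (sin (k%:R * s) * g s)).
have Fi k : I_integrable (F k).
  apply/I_integrableZ/I_integrableD; apply: I_integrableZ.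
    exact: I_integrable_cosM.
  exact: I_integrable_sinM.
transitivity (I_int (fun s => \sum_(k < m) F k s)).
  rewrite I_int_sum//; apply: eq_bigr => k _.
  have ci := I_integrable_cosM k gi; have si := I_integrable_sinM k gi.
  by rewrite /F I_intZ ?I_intD ?I_intZ//; try apply: I_integrableD;
    try exact: I_integrableZ.
apply: eq_I_int => s _; rewrite mulr_suml; apply: eq_bigr => k _.
by rewrite /F mulrBr cosB; ring.
Qed.

Lemma continuous_ord_sum m (F : nat -> R -> R) : (forall k, continuous (F k)) ->
  continuous (fun t => \sum_(k < m) F k t).
Proof.
move=> Fc; elim: m => [|m IH].
  have -> : (fun t => \sum_(k < 0) F k t) = (fun=> 0).
    by apply/funext => t; rewrite big_ord0.
  by move=> t; exact: cvg_cst.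
have -> : (fun t => \sum_(k < m.+1) F k t) = (fun t => \sum_(k < m) F k t + F m t).
  by apply/funext => t; rewrite big_ord_recr.
by move=> t; apply: cvgD; [exact: IH|exact: Fc].
Qed.

(** The tail bound of the kernel does not depend on the angle, so the partial sums converge
    uniformly at a geometric rate. The integrability and the Fourier coefficients of [conv] are
    obtained through this estimate. *)
Lemma conv_approx q g : 0 <= q < 1 -> I_integrable g ->
  exists C, forall m t, `|conv q g t - conv_sum q g m t| <= C * q ^+ m.
Proof.
move=> q01 gi; exists (2 / (1 - q) ^+ 2 * I_int (fun s => `|g s|)) => m t.
have ki : I_integrable (fun s => kerK q (t - s) * g s).
  by apply: I_integrableM => //; exact: continuous_kerK.
have si : I_integrable (fun s => (\sum_(k < m) q ^+ k * cos (k%:R * (t - s))) * g s).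
  apply: I_integrableM => //;
    apply: (@continuous_ord_sum m (fun k s => q ^+ k * cos (k%:R * (t - s)))).
  move=> k s; apply: cvgM; first exact: cvg_cst.
  apply: (@continuous_comp _ _ _ (fun u => t - u) (fun u => cos (k%:R * u)));
    last exact: continuous_cosM.
  by apply: cvgB; [exact: cvg_cst|exact: cvg_id].
rewrite conv_sumE// /conv -I_intB//.
rewrite mulrAC -I_intZ; last exact: I_integrable_norm.
apply: I_int_norm_le.
- exact: I_integrableB.
- exact/I_integrableZ/I_integrable_norm.
- by move=> s _; rewrite -mulrBl normrM ler_wpM2r// kerK_tail.
Qed.

Lemma le0_geometric C q x : 0 <= q < 1 -> (\forall m \near \oo, x <= C * q ^+ m) -> x <= 0.
Proof.
move=> /andP[q0 q1] h.
have cv : C * q ^+ m @[m --> \oo] --> (0 : R).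
  have := cvgM (@cvg_cst _ C _ \oo _) (cvg_expr (_ : `|q| < 1)).
  by rewrite mulr0; apply; rewrite ger0_norm.
rewrite -(cvg_lim _ cv)//; apply: limr_ge => //.
by apply/cvg_ex; eexists; exact: cv.
Qed.

Lemma continuous_conv_sum q g m : continuous (conv_sum q g m).
Proof.
apply: (@continuous_ord_sum m (fun k t => q ^+ k *
  (cos (k%:R * t) * I_int (fun s => cos (k%:R * s) * g s) +
   sin (k%:R * t) * I_int (fun s => sin (k%:R * s) * g s)))) => k t.
apply: cvgM; first exact: cvg_cst.
apply: cvgD; (apply: cvgM; last exact: cvg_cst).
  exact: continuous_cosM.
exact: continuous_sinM.
Qed.

(** Measurability is that of a limit of continuous partial sums; boundedness is the estimate at
    [m = 0], where the partial sum is empty. *)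
Lemma I_integrable_conv q g : 0 <= q < 1 -> I_integrable g -> I_integrable (conv q g).
Proof.
move=> q01 gi; have [C hC] := conv_approx q01 gi.
have /andP[q0 q1] := q01.
apply: (@I_integrable_le _ (fun=> C)); last 2 first.
- exact: I_integrable_cst.
- by move=> t _; have := hC 0%N t; rewrite /conv_sum big_ord0 subr0 mulr1.
apply: (measurable_fun_cvg (h := conv_sum q g)).
  by move=> m; apply: continuous_I_measurable; exact: continuous_conv_sum.
move=> t _; apply/cvgrPdist_le => e e0.
have cv : C * q ^+ m @[m --> \oo] --> (0 : R).
  have := cvgM (@cvg_cst _ C _ \oo _) (cvg_expr (_ : `|q| < 1)).
  by rewrite mulr0; apply; rewrite ger0_norm.
move/cvgrPdist_le : cv => /(_ e e0); apply: filterS => m.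
by rewrite sub0r normrN => h; rewrite (le_trans (hC m t))// (le_trans _ h)// ler_norm.
Qed.

Lemma conv_cos q n t : 0 <= q < 1 -> (0 < n)%N ->
  conv q (fun s => cos (n%:R * s)) t = pi * q ^+ n * cos (n%:R * t).
Proof.
move=> q01 n0.
have gi : I_integrable (fun s => cos (n%:R * s)).
  by apply: continuous_I_integrable; exact: continuous_cosM.
have [C hC] := conv_approx q01 gi.
apply/eqP; rewrite -subr_eq0 -normr_le0; apply: (@le0_geometric C q) => //.
exists n.+1 => // m /= nm; have := hC m t; congr (`|_ - _| <= _).
rewrite /conv_sum (bigD1 (Ordinal nm))//= I_int_coscos// eqxx I_int_sincos big1 => [|k kn].
  by ring.
rewrite I_int_coscos// I_int_sincos ifN ?mulr0 ?addr0 ?mulr0//.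
Qed.

(* The trigonometric partial sums of the kernel have separated variables, so no
   exchange of integrals is needed. *)
Lemma int_conv_cos q g n : 0 <= q < 1 -> (0 < n)%N -> I_integrable g ->
  I_int (fun t => cos (n%:R * t) * conv q g t) =
  pi * q ^+ n * I_int (fun s => cos (n%:R * s) * g s).
Proof.
move=> q01 n0 gi.
have [C hC] := conv_approx q01 gi.
have /andP[q0 q1] := q01.
have ci := I_integrable_conv q01 gi.
apply/eqP; rewrite -subr_eq0 -normr_le0; apply: (@le0_geometric (2 * pi * C) q) => //.
exists n.+1 => // m /= nm.
have si : I_integrable (conv_sum q g m).
  by apply: continuous_I_integrable; exact: continuous_conv_sum.
have <- : I_int (fun t => cos (n%:R * t) * conv_sum q g m t) =
    pi * q ^+ n * I_int (fun s => cos (n%:R * s) * g s).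
  pose F k t := cos (n%:R * t) * (q ^+ k *
    (cos (k%:R * t) * I_int (fun s => cos (k%:R * s) * g s) +
     sin (k%:R * t) * I_int (fun s => sin (k%:R * s) * g s))).
  have FE k : F k = (fun t => q ^+ k * I_int (fun s =>
    cos (k%:R * s) * g s) * (cos (k%:R * t) * cos (n%:R * t)) +
     q ^+ k * I_int (fun s => sin (k%:R * s) * g s) * (sin (k%:R * t) * cos (n%:R * t))).
    by apply/funext => t; rewrite /F; ring.
  have cci k : I_integrable (fun t => cos (k%:R * t) * cos (n%:R * t)).
    by apply: I_integrable_cosM; apply: continuous_I_integrable; exact: continuous_cosM.
  have sci k : I_integrable (fun t => sin (k%:R * t) * cos (n%:R * t)).
    by apply: I_integrable_sinM; apply: continuous_I_integrable; exact: continuous_cosM.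
  have Fi k : I_integrable (F k).
    by rewrite FE; apply: I_integrableD; exact: I_integrableZ.
  transitivity (I_int (fun t => \sum_(k < m) F k t)).
    by apply: eq_I_int => t _; rewrite /conv_sum mulr_sumr.
  have IF k : I_int (F k) = q ^+ k * I_int (fun s =>
    cos (k%:R * s) * g s) * (if k == n then pi else 0).
    rewrite FE I_intD; [|exact: I_integrableZ..].
    by rewrite !I_intZ// I_int_coscos// I_int_sincos mulr0 addr0.
  rewrite I_int_sum// (bigD1 (Ordinal nm))//= IF eqxx big1 => [|k kn]; first by ring.
  by rewrite IF ifN ?mulr0.
rewrite -I_intB; [|exact: I_integrable_cosM..].
have -> : 2 * pi * C * q ^+ m = I_int (fun=> C * q ^+ m) by rewrite I_int_cst mulrA.
apply: I_int_norm_le.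
- by apply: I_integrableB; exact: I_integrable_cosM.
- exact: I_integrable_cst.
- move=> t _; rewrite -mulrBr normrM -[leRHS]mul1r ler_pM//.
  exact: cos_max.
Qed.
End FourierModes.

(** * Layer potentials on circles *)

Section CircleGeometry.
Context {R : realType}.
Implicit Types (f : R * R -> R) (r rho a t s : R) (n : nat).

Lemma enorm_circle r t : 0 <= r -> enorm (circle r t) = r.
Proof.
move=> r0; rewrite /enorm /circle/= !exprMn -mulrDr cos2Dsin2 mulr1.
by rewrite sqrtr_sqr ger0_norm.
Qed.

Lemma normal_circle r t : 0 < r -> normal (circle r t) = (cos t, sin t).
Proof.
move=> r0; rewrite /normal enorm_circle ?ltW// /circle.
by congr (_, _); rewrite /= /GRing.scale/= mulrA mulVf ?mul1r ?gt_eqF.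
Qed.

(** The normal is radial, so the directional derivative only sees [f] along one ray. *)
Lemma normal_derivative_circle f r t : 0 < r ->
  normal_derivative f (circle r t) = (fun rho => f (circle rho t))^`()%classic r.
Proof.
move=> r0; rewrite /normal_derivative normal_circle// /derive1 /derive.
have -> : (fun h : R => h^-1 *: ((f \o shift (circle r t)) (h *: (cos t,
  sin t)) - f (circle r t))) =
    (fun h => h^-1 *: (f (circle (h + r) t) - f (circle r t))) => [|//].
apply/funext => h /=; congr (h^-1 *: (f _ - _)).
by rewrite /circle; congr (_, _); rewrite /= mulrDl.
Qed.

Lemma cos_mulV2pi n t : cos (n%:R * (t - 2 * pi)) = cos (n%:R * t).
Proof.
have -> : n%:R * t = n%:R * (t - 2 * pi) + pi *+ 2 *+ n.
  by rewrite -[X in _ = _ + X]mulr_natl -[pi *+ 2]mulr_natl; ring.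
by rewrite (periodicn (@cosD2pi R)).
Qed.

Lemma cos_arg_circle n r t : 0 < r -> 0 <= t <= 2 * pi ->
  cos (n%:R * arg (circle r t)) = cos (n%:R * t).
Proof.
move=> r0 /andP[t0 t2]; rewrite /arg enorm_circle; last exact: ltW.
rewrite /circle/= mulrAC divff ?gt_eqF// mul1r.
rewrite pmulr_rge0//; have p0 := @pi_gt0 R.
have [tpi|pit] := leP t pi.
  have -> : 0 <= sin t by rewrite sin_ge0_pi// t0.
  by rewrite cosK// in_itv/= t0.
have hc : acos (cos t) = 2 * pi - t.
  have -> : cos t = cos (2 * pi - t).
    have := cos_mulV2pi 1 t; rewrite !mul1r => <-.
    by rewrite -cosN opprB.
  by rewrite cosK// in_itv/=; apply/andP; split; lra.
(* Past [pi] the argument is [t - 2 * pi]; at [t = 2 * pi] the second coordinate is 0 and the other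
   sign is taken. Evenness of the cosine covers both. *)
rewrite hc; case: ifP => _.
  by rewrite -[RHS]cos_mulV2pi -[RHS]cosN -mulrN opprB.
by rewrite opprB cos_mulV2pi.
Qed.

Lemma polar_harmonic_circle n r t : 0 < r -> 0 <= t <= 2 * pi ->
  polar_harmonic n (circle r t) = r ^+ n * cos (n%:R * t).
Proof. by move=> r0 t2; rewrite /polar_harmonic enorm_circle ?ltW// cos_arg_circle. Qed.

Lemma normal_derivative_polar_harmonic n r t : 0 < r -> 0 <= t <= 2 * pi ->
  normal_derivative (polar_harmonic n) (circle r t) = n%:R * r ^+ n.-1 * cos (n%:R * t).
Proof.
move=> r0 t2; rewrite normal_derivative_circle// derive1E.
have dX : is_derive r (1 : R) (@GRing.exp R ^~ n) (n%:R * r ^+ n.-1).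
  by apply: DeriveDef; [exact: exprn_derivable|rewrite exp_derive /GRing.scale/= mulr1].
have dF := is_deriveZ (cos (n%:R * t)) dX.
rewrite (@near_eq_derive _ _ _ _ (cos (n%:R * t) \*: (fun rho : R => rho ^+ n))).
  by have [_ ->] := dF; rewrite /GRing.scale/= mulrC.
near=> rho; rewrite polar_harmonic_circle//; first by rewrite /GRing.scale/= mulrC.
by near: rho; exact: lt_nbhsr.
Unshelve. all: by end_near. Qed.

Definition dist2 rho a t : R := rho ^+ 2 + a ^+ 2 - 2 * rho * a * cos t.

Lemma G_circle rho a t s :
  G (circle rho t - circle a s) = ln (Num.sqrt (dist2 rho a (t - s))) / (2 * pi).
Proof.
rewrite /G /enorm /circle/=; congr (ln (Num.sqrt _) / _).
have ct : sin t ^+ 2 = 1 - cos t ^+ 2 by rewrite -(cos2Dsin2 t); ring.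
have cs : sin s ^+ 2 = 1 - cos s ^+ 2 by rewrite -(cos2Dsin2 s); ring.
by rewrite /dist2 cosB !sqrrB !exprMn ct cs; ring.
Qed.

Lemma dist2_ge rho a t : 0 <= rho -> 0 <= a -> (rho - a) ^+ 2 <= dist2 rho a t.
Proof.
move=> rho0 a0; have c1 := cos_le1 t; rewrite /dist2 sqrrB.
have : 0 <= rho * a * (1 - cos t) by rewrite !mulr_ge0// subr_ge0.
lra.
Qed.

Lemma dist2_gt0 rho a t : 0 <= rho -> 0 <= a -> rho != a -> 0 < dist2 rho a t.
Proof.
move=> rho0 a0 ra; apply: lt_le_trans (dist2_ge t rho0 a0).
by rewrite exprn_even_gt0//= subr_eq0.
Qed.

Lemma is_derive_G rho a t s : 0 < dist2 rho a (t - s) ->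
  is_derive rho (1 : R) (fun u => G (circle u t - circle a s))
    ((rho - a * cos (t - s)) / (2 * pi * dist2 rho a (t - s))).
Proof.
move=> D0.
have -> : (fun u => G (circle u t - circle a s)) =
   (fun u => (2 * pi)^-1 * ln (Num.sqrt (dist2 u a (t - s)))).
  by apply/funext => u; rewrite G_circle mulrC.
have p0 := @pi_gt0 R.
have dD : is_derive rho (1 : R) (fun u =>
  dist2 u a (t - s)) (2 * rho - 2 * a * cos (t - s)).
  by rewrite /dist2; apply: is_derive_eq; rewrite /GRing.scale/=; ring.
pose D u := dist2 u a (t - s).
have dS := @is_derive1_comp R (@Num.sqrt R) D rho _ _ (is_derive1_sqrt D0) dD.
have S0 : 0 < Num.sqrt (dist2 rho a (t - s)) by rewrite sqrtr_gt0.
have dL := @is_derive1_comp R (@ln R) (@Num.sqrt R \o D) rho _ _ (is_derive1_ln S0) dS.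
have dZ := is_deriveZ (2 * pi)^-1 dL.
rewrite [X in is_derive _ _ _ X](_ : _ = (2 * pi)^-1 *: ((Num.sqrt (D rho))^-1 *
  ((2 * Num.sqrt (D rho))^-1 * (2 * rho - 2 * a * cos (t - s)))))//.
rewrite /GRing.scale/= /D.
have h : Num.sqrt (dist2 rho a (t - s)) ^+ 2 = dist2 rho a (t - s) by rewrite sqr_sqrtr//
  ltW.
rewrite -[in LHS]h; move: (@pi R) p0 => p p0; field.
by rewrite (gt_eqF S0) (gt_eqF p0).
Qed.

End CircleGeometry.

(** * Single layers and [Kstar] on concentric circles *)

Section LayerPotentials.
Context {R : realType}.
Local Notation mu := (@lebesgue_measure R).
Local Notation I := (`[0, 2 * pi]%classic : set R).
Implicit Types (phi : R * R -> R) (f g : R -> R) (r rho a t s q : R) (n : nat).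

(** Measurability of [f] is inherited from [g], as subsets of a countable set are measurable. This
    serves for a kernel whose value at the singular parameters is uncontrolled. *)
Lemma I_int_eq_off_countable f g (A : set R) : countable A -> I_integrable g ->
  (forall s, I s -> ~ A s -> f s = g s) -> I_int f = I_int g.
Proof.
move=> cA gi fg.
have mg := I_integrable_measurable gi.
have mA (B : set R) : B `<=` A -> measurable B.
  move=> BA; apply: countable_measurable; first exact: measurable_set1.
  exact: sub_countable (subset_card_le BA) cA.
have mf : measurable_fun I f.
  move=> mI Y mY.
  have -> : I `&` f @^-1` Y = ((I `&` g @^-1` Y) `\` A) `|` ((I `&` f @^-1` Y) `&` A).
    apply/seteqP; split => s /=.
      move=> [Is fs]; have [As|nAs] := pselect (A s); [by right|left].
      by split => //; split => //; rewrite /= -fg.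
    by move=> [[[Is gs] nAs]|[]//]; split => //=; rewrite fg.
  apply: measurableU; last by apply: mA; exact: subIsetr.
  by apply: measurableD; [exact: mg|exact: mA].
congr fine; apply: ae_eq_integral => //.
- exact/measurable_EFinP.
- exact/measurable_EFinP.
exists A; split.
- exact: mA.
- exact: countable_lebesgue_measure0.
- move=> s /= h; apply: contrapT => nA; apply: h => Is; by rewrite fg.
Qed.

Lemma I_E t : I t = (0 <= t <= 2 * pi) :> Prop.
Proof. by rewrite /= in_itv. Qed.

Lemma cos_eq1_I t s : I t -> I s -> cos (t - s) = 1 ->
  [set t; t - 2 * pi; t + 2 * pi] s.
Proof.
rewrite !I_E => /andP[t0 t2] /andP[s0 s2] c1.
have p0 := @pi_gt0 R.
have H (x : R) : 0 < x < 2 * pi -> cos x != 1.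
  move=> /andP[x0 x2].
  have -> : cos x = 1 - 2 * sin (x / 2) ^+ 2.
    have {1}-> : x = x / 2 + x / 2 by field.
    by rewrite cosD; have := cos2Dsin2 (x / 2); lra.
  have h : 0 < sin (x / 2) by apply: sin_gt0_pi; apply/andP; split; lra.
  have h2 : 0 < sin (x / 2) ^+ 2 by rewrite exprn_gt0.
  by rewrite lt_eqF//; lra.
have [ts|st|->] := ltgtP t s; last by left; left.
- have [e|ne] := eqVneq s (t + 2 * pi); first by right.
  have : cos (s - t) != 1.
    by apply: H; apply/andP; split; move: ne; rewrite neq_lt => /orP[|]; lra.
  by rewrite -cosN opprB c1 eqxx.
- have [e|ne] := eqVneq s (t - 2 * pi); first by left; right.
  have : cos (t - s) != 1.
    by apply: H; apply/andP; split; move: ne; rewrite neq_lt => /orP[|]; lra.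
  by rewrite c1 eqxx.
Qed.

Lemma L20_integrable r phi : L20 r phi -> I_integrable (fun s => phi (circle r s)).
Proof.
move=> [mphi phi2 _].
apply: (@I_integrable_le _ _ (fun s => 1 + phi (circle r s) ^+ 2)) => //.
  by apply: I_integrableD; [exact: I_integrable_cst|exact: phi2].
move=> s _; set x := phi _.
have [x1|/ltW x1] := leP `|x| 1.
  by rewrite (le_trans x1)// lerDl sqr_ge0.
have : `|x| <= x ^+ 2 by rewrite -real_normK ?num_real// ler_eXnr.
by move=> h; rewrite (le_trans h)// lerDr.
Qed.

Lemma L20_int r phi : 0 < r -> L20 r phi -> I_int (fun s => phi (circle r s)) = 0.
Proof.
move=> r0 h; have gi := L20_integrable h; case: h => _ _ h.
apply: (mulfI (lt0r_neq0 r0)); rewrite mulr0 -h -I_intZ//.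
by apply: eq_I_int => s _; rewrite mulrC.
Qed.

Lemma normal_derivative_G rho a t s : 0 < rho -> 0 < dist2 rho a (t - s) ->
  normal_derivative (fun z => G (z - circle a s)) (circle rho t) =
  (rho - a * cos (t - s)) / (2 * pi * dist2 rho a (t - s)).
Proof.
move=> rho0 D0; rewrite normal_derivative_circle// derive1E.
by have [_ ->] := is_derive_G D0.
Qed.

(** Off the diagonal the kernel on a circle is the constant [1 / (4 pi r)], so only the mean of the
    density enters, and this is 0. *)
Lemma Kstar_eq0 r phi t : 0 < r -> L20 r phi -> I t -> Kstar r phi (circle r t) = 0.
Proof.
move=> r0 h It.
have gi := L20_integrable h.
have p0 := @pi_gt0 R.
transitivity (I_int (fun s => (4 * pi)^-1 * phi (circle r s))); last first.
  by rewrite I_intZ// (L20_int r0 h) mulr0.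
apply: (@I_int_eq_off_countable _ _ [set t; t - 2 * pi; t + 2 * pi]).
- by apply: finite_set_countable; rewrite !finite_setU; split; [split|]; exact: finite_set1.
- exact: I_integrableZ.
move=> s Is nA.
have cn1 : cos (t - s) != 1 by apply/eqP => c1; apply: nA; exact: cos_eq1_I.
have c1 : 0 < 1 - cos (t - s) by rewrite subr_gt0 lt_neqAle cn1 cos_le1.
have DE : dist2 r r (t - s) = 2 * r ^+ 2 * (1 - cos (t - s)) by rewrite /dist2; ring.
have D0 : 0 < dist2 r r (t - s) by rewrite DE !mulr_gt0// exprn_gt0.
rewrite normal_derivative_G// DE; move: (@pi R) p0 (cos _) c1 => p p0 c c1.
by field; rewrite (gt_eqF p0) (gt_eqF r0) (gt_eqF c1).
Qed.


Lemma continuous_G_circle rho a t : 0 < rho -> 0 < a -> rho != a ->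
  continuous (fun s => G (circle rho t - circle a s)).
Proof.
move=> rho0 a0 ra.
have -> : (fun s => G (circle rho t - circle a s)) =
   (fun s => ln (Num.sqrt (dist2 rho a (t - s))) / (2 * pi)).
  by apply/funext => s; rewrite G_circle.
move=> s; apply: cvgM; last exact: cvg_cst.
have D0 := dist2_gt0 (t - s) (ltW rho0) (ltW a0) ra.
have S0 : 0 < Num.sqrt (dist2 rho a (t - s)) by rewrite sqrtr_gt0.
apply: (@continuous_comp _ _ _ (fun s => Num.sqrt (dist2 rho a (t - s))) (@ln R));
  last exact: continuous_ln.
apply: (@continuous_comp _ _ _ (fun s => dist2 rho a (t - s)) (@Num.sqrt R));
  last exact: sqrt_continuous.
apply: cvgB; first exact: cvg_cst.
apply: cvgM; first exact: cvg_cst.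
apply: (@continuous_comp _ _ _ (fun u => t - u) cos); last exact: continuous_cos.
by apply: cvgB; [exact: cvg_cst|exact: cvg_id].
Qed.

(** Up to [2 pi] the real part of [1 / (rho - a e^(it))], hence a geometric series in [a / rho] or
    in [rho / a], according to which radius is larger. *)
Definition radial_kernel rho a t : R := (rho - a * cos t) / (2 * pi * dist2 rho a t).

Lemma normal_derivative_single_layer rho a t phi : 0 < rho -> 0 < a -> rho != a ->
  I_integrable (fun s => phi (circle a s)) ->
  normal_derivative (single_layer a phi) (circle rho t) =
  I_int (fun s => radial_kernel rho a (t - s) * (a * phi (circle a s))).
Proof.
move=> rho0 a0 ra gi.
have p0 := @pi_gt0 R.
rewrite normal_derivative_circle//.
pose F u s := (a * phi (circle a s)) * G (circle u t - circle a s).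
have -> : (fun u => single_layer a phi (circle u t)) = (fun u => \int[mu]_(s in I) F u s).
  by apply/funext => u; apply: eq_I_int => s _; rewrite /F; ring.
(* Half the gap: radii within [d] of [rho] stay positive and at distance at least [e] from the
   singular radius [a]. *)
pose e := `|rho - a| / 2.
have e0 : 0 < e by rewrite divr_gt0// normr_gt0 subr_eq0.
pose d := Num.min e rho.
have d0 : 0 < d by rewrite lt_min e0.
have near u : `]rho - d, rho + d[%classic u -> [/\ 0 < u, u < 2 * rho & e <= `|u - a|].
  rewrite /= in_itv/= => /andP[u1 u2].
  have de : d <= e by rewrite ge_min lexx.
  have dr : d <= rho by rewrite ge_min lexx orbT.
  split; [lra|lra|].
  have : `|rho - a| <= `|rho - u| + `|u - a| by rewrite (le_trans _ (ler_normD _ _))//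
    addrA subrK.
  have : `|rho - u| < d by rewrite ltr_norml; apply/andP; split; lra.
  by rewrite /e in de *; lra.
have ud u s : `]rho - d, rho + d[%classic u ->
    is_derive u (1 : R) (fun v =>
      F v s) (radial_kernel u a (t - s) * (a * phi (circle a s))).
  move=> /near[u0 _ ua].
  have una : u != a by rewrite -subr_eq0 -normr_gt0 (lt_le_trans e0).
  have dG := is_derive_G (dist2_gt0 (t - s) (ltW u0) (ltW a0) una).
  have := is_deriveZ (a * phi (circle a s)) dG.
  by rewrite [X in is_derive _ _ _ X]mulrC.
have rhoI : `]rho - d, rho + d[%classic rho.
  by rewrite /= in_itv/=; apply/andP; split; lra.
(* Dominates the kernel near [rho]: the numerator is at most [u + a] with [u < 2 * rho], and [dist2]
   is at least [e ^+ 2]. *)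
pose M := (2 * rho + a) / (2 * pi * e ^+ 2).
have M0 : 0 <= M by rewrite divr_ge0//; [lra|rewrite mulr_ge0 ?sqr_ge0//; lra].
rewrite (@differentiation_under_integral _ _ _ mu F I _ rho (rho - d) (rho + d) _ _ _
   (fun s => M * (a * `|phi (circle a s)|))).
- by apply: eq_I_int => s _; rewrite partial1of2E; have [_ ->] := ud rho s rhoI.
- exact: measurable_I.
- exact: rhoI.
- move=> u /near[u0 _ ua].
  have una : u != a by rewrite -subr_eq0 -normr_gt0 (lt_le_trans e0).
  have := I_integrableM (continuous_G_circle (t := t) u0 a0 una) (I_integrableZ a gi).
  by congr (I_integrable _); apply/funext => s; rewrite /F mulrC.
- by move=> u s uI _; have [] := ud u s uI.
- by move=> s; rewrite mulr_ge0// mulr_ge0// ltW.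
- exact/I_integrableZ/I_integrableZ/I_integrable_norm.
move=> u s uI _; rewrite partial1of2E; have [_ ->] := ud u s uI.
have [u0 u2 ua] := near u uI.
rewrite normrM [`|a * _|]normrM (gtr0_norm a0) ler_wpM2r ?mulr_ge0 ?(ltW a0)//.
have una : u != a by rewrite -subr_eq0 -normr_gt0 (lt_le_trans e0).
have D0 := dist2_gt0 (t - s) (ltW u0) (ltW a0) una.
have De : e ^+ 2 <= dist2 u a (t - s).
  rewrite (le_trans _ (dist2_ge _ (ltW u0) (ltW a0)))// -[leRHS]real_normK ?num_real//.
  by rewrite lerXn2r// nnegrE// ltW.
rewrite /radial_kernel normrM normfV.
have D20 : 0 < 2 * pi * dist2 u a (t - s) by rewrite !mulr_gt0.
rewrite (gtr0_norm D20) /M ler_pM//.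
- by rewrite invr_ge0 ltW.
- rewrite (le_trans (ler_normB _ _))// normrM (gtr0_norm u0) (gtr0_norm a0).
  have : a * `|cos (t - s)| <= a by rewrite ler_piMr ?(ltW a0)// cos_max.
  by lra.
- have E20 : 0 < 2 * pi * e ^+ 2 by rewrite mulr_gt0 ?exprn_gt0// mulr_gt0.
  by rewrite lef_pV2 ?posrE// ler_wpM2l// mulr_ge0// ltW.
Qed.

Lemma radial_kernel_outside rho a t : 0 < rho -> 0 < a -> a < rho ->
  radial_kernel rho a t = (2 * pi * rho)^-1 * kerK (a / rho) t.
Proof.
move=> rho0 a0 ar; have p0 := @pi_gt0 R.
have q01 : 0 <= a / rho < 1 by rewrite divr_ge0 ?ltW//= ltr_pdivrMr// mul1r.
have D0 := dist2_gt0 t (ltW rho0) (ltW a0) (negbT (gt_eqF ar)).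
have K0 := kerK_den_gt0 t q01.
have DE : dist2 rho a t = rho ^+ 2 * (1 - 2 * (a / rho) * cos t + (a / rho) ^+ 2).
  by rewrite /dist2; field; rewrite gt_eqF.
rewrite /radial_kernel DE /kerK; move: K0 {DE D0}.
set K := (1 - _ + _) => K0; move: (@pi R) p0 K K0 => p p0 K K0.
by field; rewrite !gt_eqF.
Qed.

Lemma radial_kernel_inside rho a t : 0 < rho -> 0 < a -> rho < a ->
  radial_kernel rho a t = (2 * pi * rho)^-1 * (1 - kerK (rho / a) t).
Proof.
move=> rho0 a0 ar; have p0 := @pi_gt0 R.
have q01 : 0 <= rho / a < 1 by rewrite divr_ge0 ?ltW//= ltr_pdivrMr// mul1r.
have K0 := kerK_den_gt0 t q01.
have DE : dist2 rho a t = a ^+ 2 * (1 - 2 * (rho / a) * cos t + (rho / a) ^+ 2).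
  by rewrite /dist2; field; rewrite gt_eqF.
rewrite /radial_kernel DE /kerK.
have cE : rho - a * cos t = a ^+ 2 / rho * ((1 - 2 * (rho / a) * cos t + (rho / a) ^+ 2)
  - (1 - rho / a * cos t)).
  by field; rewrite !gt_eqF.
rewrite cE; move: K0 {DE cE}.
set K := (1 - _ + _) => K0; move: (@pi R) p0 K K0 => p p0 K K0.
by field; rewrite !gt_eqF.
Qed.

Lemma normal_derivative_single_layer_outside rho a t phi : 0 < rho -> 0 < a -> a < rho ->
  I_integrable (fun s => phi (circle a s)) ->
  normal_derivative (single_layer a phi) (circle rho t) =
  a / (2 * pi * rho) * conv (a / rho) (fun s => phi (circle a s)) t.
Proof.
move=> rho0 a0 ar gi; rewrite normal_derivative_single_layer ?gt_eqF//.
have q01 : 0 <= a / rho < 1 by rewrite divr_ge0 ?ltW//= ltr_pdivrMr// mul1r.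
rewrite /conv -I_intZ; last by apply: I_integrableM => //; exact: continuous_kerK.
by apply: eq_I_int => s _; rewrite radial_kernel_outside//; ring.
Qed.

(** Inside the circle the kernel is proportional to [1 - kerK]; the constant 1 integrates to 0
    against a mean-zero density. *)
Lemma normal_derivative_single_layer_inside rho a t phi : 0 < rho -> 0 < a -> rho < a ->
  L20 a phi ->
  normal_derivative (single_layer a phi) (circle rho t) =
  - (a / (2 * pi * rho)) * conv (rho / a) (fun s => phi (circle a s)) t.
Proof.
move=> rho0 a0 ar ph; have gi := L20_integrable ph.
rewrite normal_derivative_single_layer ?lt_eqF//.
have q01 : 0 <= rho / a < 1 by rewrite divr_ge0 ?ltW//= ltr_pdivrMr// mul1r.
have ci : I_integrable (fun s => kerK (rho / a) (t - s) * phi (circle a s)).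
  by apply: I_integrableM => //; exact: continuous_kerK.
transitivity (I_int (fun s => a / (2 * pi * rho) * phi (circle a s) -
    a / (2 * pi * rho) * (kerK (rho / a) (t - s) * phi (circle a s)))).
  by apply: eq_I_int => s _; rewrite radial_kernel_inside//; ring.
rewrite I_intB; [|exact: I_integrableZ..].
by rewrite !I_intZ// (L20_int a0 ph) mulr0 sub0r mulNr.
Qed.

End LayerPotentials.

(** * Generalized polarization tensors *)

Section ModeSystem.
Context {R : realType}.
Local Notation mu := (@lebesgue_measure R).
Local Notation I := (`[0, 2 * pi]%classic : set R).
Variables (N : nat) (rad eta : nat -> R) (n : nat).
Hypothesis n0 : (0 < n)%N.
Hypothesis rad0 : forall k, 0 < rad k.
Hypothesis rad_decr : forall j k, (j < k <= N.+1)%N -> rad k < rad j.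

(** Radii decrease with the index: for [k < j] the interface [j] lies inside the circle [k], which
    explains the ratio here and the sign in the weight below. *)
Definition layer_ratio j k : R := if (k < j)%N then rad j / rad k else rad k / rad j.
Definition layer_weight j k : R := if (k < j)%N then - (rad k / (2 * pi * rad j)) else
  rad k / (2 * pi * rad j).

Lemma layer_ratio_itv j k : (j <= N.+1)%N -> (k <= N.+1)%N -> k != j -> 0 <= layer_ratio
  j k < 1.
Proof.
move=> jN kN kj; rewrite /layer_ratio; case: ltnP => h.
  by rewrite divr_ge0 ?(ltW (rad0 _))//= ltr_pdivrMr// mul1r rad_decr// h.
have {}h : (j < k)%N by rewrite ltn_neqAle eq_sym kj.
by rewrite divr_ge0 ?(ltW (rad0 _))//= ltr_pdivrMr// mul1r rad_decr// h.
Qed.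

Lemma I_integrable_big (s : seq nat) (P : pred nat) (F : nat -> R -> R) :
  (forall k, k \in s -> P k -> I_integrable (F k)) ->
  I_integrable (fun t => \sum_(k <- s | P k) F k t) /\
  I_int (fun t => \sum_(k <- s | P k) F k t) = \sum_(k <- s | P k) I_int (F k).
Proof.
elim: s => [|k s IH] h.
  have -> : (fun t => \sum_(k <- [::] | P k) F k t) = (fun=> 0).
    by apply/funext => t; rewrite big_nil.
  by split; [exact: I_integrable_cst|rewrite I_int_cst mulr0 big_nil].
have [|i1 i2] := IH; first by move=> l ls; apply: h; rewrite inE ls orbT.
rewrite big_cons; case: ifPn => Pk.
  have -> : (fun t => \sum_(k <- k :: s | P k) F k t) =
      (fun t => F k t + \sum_(k <- s | P k) F k t).
    by apply/funext => t; rewrite big_cons Pk.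
  have Fk : I_integrable (F k) by apply: h => //; exact: mem_head.
  by split; [exact: I_integrableD|rewrite I_intD// i2].
have -> : (fun t => \sum_(k <- k :: s | P k) F k t) = (fun t => \sum_(k <- s | P k) F k t).
  by apply/funext => t; rewrite big_cons (negbTE Pk).
by [].
Qed.

Definition mode_system (a : nat -> R) := forall j, (1 <= j <= N.+1)%N ->
  a j - 2 * eta j * (\sum_(1 <= k < N.+2 | k != j) layer_weight j k * (pi * layer_ratio j
    k ^+ n) * a k)
  = 2 * eta j * (n%:R * rad j ^+ n.-1 * pi).

(** Scaling by [rad k ^+ n.+1] makes each unknown the contribution of one interface to the moment,
    and reduces all interactions to 1 or a ratio of the [x k]. *)
Lemma mode_systemE (a : nat -> R) (x : nat -> R) :
  (forall k, (k <= N.+1)%N -> x k = rad k ^+ n * rad k ^+ n) ->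
  mode_system a <-> layer_system N eta x (2 * pi * n%:R) (fun k => rad k ^+ n.+1 * a k).
Proof.
move=> xE.
have p0 := @pi_gt0 R.
suff H j : (1 <= j <= N.+1)%N ->
  rad j ^+ n.+1 * (a j - 2 * eta j * (\sum_(1 <= k < N.+2 | k != j) layer_weight j k *
    (pi * layer_ratio j k ^+ n) * a k)) =
    rad j ^+ n.+1 * a j - eta j * (\sum_(1 <= k < N.+2 | k != j) coupling x j k * (rad k
      ^+ n.+1 * a k)) /\
  rad j ^+ n.+1 * (2 * eta j * (n%:R * rad j ^+ n.-1 * pi)) = eta j * (2 * pi * n%:R * x j).
  have rn j : rad j ^+ n.+1 != 0 by rewrite expf_neq0// gt_eqF.
  split=> h j j1; have [H1 H2] := H j j1.
    by rewrite -H1 h// H2.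
  by apply: (mulfI (rn j)); rewrite H1 H2 h.
move=> /andP[j1 jN]; split; last first.
  rewrite xE//; case: (n) n0 => // m _; rewrite !exprS/=; ring.
rewrite mulrBr; congr (_ - _).
rewrite [LHS](_ : _ = eta j * (2 * rad j ^+ n.+1 * (\sum_(1 <= k < N.+2 | k != j)
  layer_weight j k * (pi * layer_ratio j k ^+ n) * a k))); last by ring.
congr (_ * _); rewrite mulr_sumr big_nat_cond [RHS]big_nat_cond; apply: eq_bigr => k.
move=> /andP[/andP[k1 kN] kj].
have rj := lt0r_neq0 (rad0 j); have rk := lt0r_neq0 (rad0 k).
rewrite /coupling /layer_weight /layer_ratio !xE//; case: ltnP => h;
  rewrite expr_div_n !exprS.
  move: (@pi R) p0 (rad j ^+ n) (rad k ^+ n) (expf_neq0 n rj) (expf_neq0 n rk) =>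
    p p0 u v u0 v0.
  by field; rewrite ?(gt_eqF p0) ?rj ?rk ?v0.
move: (@pi R) p0 (rad j ^+ n) (rad k ^+ n) (expf_neq0 n rj) (expf_neq0 n rk) =>
  p p0 u v u0 v0.
by field; rewrite ?(gt_eqF p0) ?rj ?rk ?u0.
Qed.

Definition layer_coeff (phi : nat -> R * R -> R) k : R :=
  I_int (fun s => cos (n%:R * s) * phi k (circle (rad k) s)).


Let layer_term phi j k t : (1 <= j <= N.+1)%N -> (1 <= k <= N.+1)%N -> k != j ->
  L20 (rad k) (phi k) ->
  normal_derivative (single_layer (rad k) (phi k)) (circle (rad j) t) =
  layer_weight j k * conv (layer_ratio j k) (fun s => phi k (circle (rad k) s)) t.
Proof.
move=> /andP[j1 jN] /andP[k1 kN] kj ph; rewrite /layer_weight /layer_ratio; case: ltnP => h.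
  by apply: normal_derivative_single_layer_inside => //; rewrite rad_decr// h.
have {}h : (j < k)%N by rewrite ltn_neqAle eq_sym kj.
apply: normal_derivative_single_layer_outside => //; first by rewrite rad_decr// h.
exact: L20_integrable.
Qed.

Lemma density_mode_system phi : is_density N rad eta n phi -> mode_system (layer_coeff phi).
Proof.
move=> [phL phE] j j1; have /andP[j0 jN] := j1.
have gi k : (1 <= k <= N.+1)%N -> I_integrable (fun s => phi k (circle (rad k) s)).
  by move=> k1; exact: L20_integrable (phL k k1).
pose F k t := layer_weight j k * conv (layer_ratio j k) (fun s =>
  phi k (circle (rad k) s)) t.
have kr k : k \in index_iota 1 N.+2 -> (1 <= k <= N.+1)%N by rewrite mem_index_iota.
have ci k : k \in index_iota 1 N.+2 -> k != j ->
    I_integrable (conv (layer_ratio j k) (fun s => phi k (circle (rad k) s))).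
  move=> /kr k1 kj; have /andP[_ kN] := k1.
  by apply: I_integrable_conv; [exact: layer_ratio_itv|exact: gi].
have Fi k : k \in index_iota 1 N.+2 -> k != j -> I_integrable (F k).
  by move=> k1 kj; apply: I_integrableZ; exact: ci.
have [Si _] := I_integrable_big Fi.
pose h t := 2 * eta j * (\sum_(1 <= k < N.+2 | k != j) F k t) +
   2 * eta j * (n%:R * rad j ^+ n.-1 * cos (n%:R * t)).
have cni : I_integrable (fun t : R => cos (n%:R * t)).
  by apply: continuous_I_integrable; exact: continuous_cosM.
have hi : I_integrable h.
  by apply: I_integrableD; [exact: I_integrableZ|apply: I_integrableZ;
    exact: I_integrableZ].
(* The integral equation holds almost everywhere only, so it is used under the integral against
   [cos (n t)]; each convolution will then contribute [pi q^n] times a coefficient. *)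
have E : layer_coeff phi j = I_int (fun t => cos (n%:R * t) * h t).
  have pi1 := I_integrable_cosM n (gi j j1).
  have pi2 := I_integrable_cosM n hi.
  congr fine; apply: ae_eq_integral.
  - exact: measurable_I.
  - by have /integrableP[] := pi1.
  - by have /integrableP[] := pi2.
  have := phE j j1; rewrite /circle_ae; apply: filterS;
    first exact: (ae_filter_ringOfSetsType mu).
  move=> t ht It; congr (EFin (_ * _)).
  have It2 : 0 <= t <= 2 * pi by move: It; rewrite /= in_itv.
  have := ht _; rewrite in_itv/= => /(_ It2).
  rewrite (Kstar_eq0 (rad0 j) (phL j j1))// mulr0 subr0.
  rewrite normal_derivative_polar_harmonic//.
  rewrite (_ : \sum_(1 <= k < N.+2 | k != j) _ = \sum_(1 <= k < N.+2 | k != j) F k t).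
    by move=> e; rewrite /h -e; ring.
  rewrite big_nat_cond [RHS]big_nat_cond; apply: eq_bigr => k /andP[k1 kj].
  by apply: layer_term => //; exact: phL.
rewrite E; have -> : (fun t => cos (n%:R * t) * h t) =
  (fun t => 2 * eta j * (\sum_(1 <= k < N.+2 | k != j) layer_weight j k *
      (cos (n%:R * t) * conv (layer_ratio j k) (fun s => phi k (circle (rad k) s)) t)) +
    2 * eta j * (n%:R * rad j ^+ n.-1) * (cos (n%:R * t) * cos (n%:R * t))).
  apply/funext => t; rewrite /h mulrDr; congr (_ + _); last by ring.
  by rewrite mulrCA; congr (_ * _); rewrite mulr_sumr; apply: eq_bigr => k _; rewrite /F;
    ring.
have Gi k : k \in index_iota 1 N.+2 -> k != j -> I_integrable (fun t => layer_weight j k *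
      (cos (n%:R * t) * conv (layer_ratio j k) (fun s => phi k (circle (rad k) s)) t)).
  by move=> k1 kj; apply/I_integrableZ/I_integrable_cosM; exact: ci.
have [Gs GE] := I_integrable_big Gi.
rewrite I_intD; [|exact: I_integrableZ|by apply/I_integrableZ/I_integrable_cosM].
rewrite I_intZ// GE I_intZ; last exact: I_integrable_cosM.
rewrite I_int_coscos// eqxx.
rewrite (_ : \sum_(1 <= k < N.+2 | k != j) I_int _ =
  \sum_(1 <= k < N.+2 | k != j) layer_weight j k * (pi * layer_ratio j k ^+ n) *
    layer_coeff phi k); first by ring.
rewrite big_nat_cond [RHS]big_nat_cond; apply: eq_bigr => k /andP[k1 kj].
have kI : k \in index_iota 1 N.+2 by rewrite mem_index_iota.
have /andP[_ kN] := k1.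
rewrite I_intZ; last by apply: I_integrable_cosM; exact: ci.
by rewrite int_conv_cos ?mulrA//; [exact: layer_ratio_itv|exact: gi].
Qed.

Lemma moment_density phi : is_density N rad eta n phi ->
  moment N rad n phi = \sum_(1 <= k < N.+2) rad k ^+ n.+1 * layer_coeff phi k.
Proof.
move=> [phL _]; rewrite /moment big_nat_cond [RHS]big_nat_cond.
apply: eq_bigr => k /andP[k1 _].
have gi := L20_integrable (phL k k1).
rewrite -I_intZ; last exact: I_integrable_cosM.
apply: eq_I_int => t It; have It2 : 0 <= t <= 2 * pi by move: It; rewrite /= in_itv.
by rewrite polar_harmonic_circle// exprS; ring.
Qed.

(** Pure cosines suffice, as convolution maps [cos (n t)] to a multiple of itself. The division by
    [pi], the integral of [cos (n t) ^ 2], makes [a k] the coefficient of [phi k]. *)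
Lemma mode_system_density a : mode_system a -> exists phi, is_density N rad eta n phi.
Proof.
move=> ha; have p0 := @pi_gt0 R.
pose phi k (y : R * R) := a k / pi * cos (n%:R * arg y).
have phE k t : I t -> phi k (circle (rad k) t) = a k / pi * cos (n%:R * t).
  by rewrite /= in_itv/= => It; rewrite /phi cos_arg_circle.
have cc k : continuous (fun t : R => a k / pi * cos (n%:R * t)).
  by move=> t; apply: cvgM; [exact: cvg_cst|exact: continuous_cosM].
have phL k : L20 (rad k) (phi k).
  split.
  - apply: (@eq_measurable_fun _ _ _ _ I (fun t : R => a k / pi * cos (n%:R * t))).
      by move=> t /set_mem It; rewrite /= phE.
    by apply: continuous_I_measurable; exact: cc.
  - apply: (@eq_integrable _ _ _ mu I _ (EFin \o (fun t : R =>
    a k / pi * cos (n%:R * t) * (a k / pi * cos (n%:R * t))))).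
    + exact: measurable_I.
    + by move=> t /set_mem It; rewrite /= phE// expr2.
    + by apply: continuous_I_integrable => t; apply: cvgM; exact: cc.
  - transitivity (I_int (fun t => rad k * (a k / pi) * cos (n%:R * t))).
      by apply: eq_I_int => t It; rewrite phE//; ring.
    rewrite I_intZ; first by rewrite [X in _ * X]int_cos// mulr0.
    by apply: continuous_I_integrable; exact: continuous_cosM.
exists phi; split=> [j _|j j1]; first exact: phL.
apply: aeW => t; rewrite in_itv/= => It2.
have It : I t by rewrite /= in_itv.
rewrite (Kstar_eq0 (rad0 j) (phL j))// mulr0 subr0 normal_derivative_polar_harmonic// phE//.
have /andP[_ jN] := j1.
rewrite (_ : \sum_(1 <= k < N.+2 | k != j) _ =
  (\sum_(1 <= k < N.+2 | k != j) layer_weight j k * (pi * layer_ratio j k ^+ n) * a k) /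
    pi * cos (n%:R * t)).
  have -> : 2 * eta j * (n%:R * rad j ^+ n.-1 * cos (n%:R * t)) =
      (2 * eta j * (n%:R * rad j ^+ n.-1 * pi)) / pi * cos (n%:R * t).
    by rewrite [in RHS]mulrA mulfK ?gt_eqF//; ring.
  by rewrite -ha//; ring.
rewrite !mulr_suml big_nat_cond [RHS]big_nat_cond; apply: eq_bigr => k /andP[k1 kj].
have /andP[_ kN] := k1.
rewrite layer_term//.
transitivity (layer_weight j k * (a k / pi * conv (layer_ratio j k) (fun s =>
  cos (n%:R * s)) t)).
  congr (_ * _); rewrite /conv -I_intZ.
    by apply: eq_I_int => s Is; rewrite phE//; ring.
  apply: I_integrableM; first by apply: continuous_kerK; exact: layer_ratio_itv.
  by apply: continuous_I_integrable; exact: continuous_cosM.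
by rewrite conv_cos//; [ring|exact: layer_ratio_itv].
Qed.

End ModeSystem.

(** * Vanishing of the moment as a zero of the Schur numerator *)

Section VanishingCriterion.
Context {R : realType}.
Variables (N : nat) (r gamma : R).
Hypothesis r0 : 0 < r.
Hypothesis gamma1 : 1 < gamma.

Let g0 : 0 < gamma. Proof. exact: lt_trans gamma1. Qed.

Lemma layer_radius_gt0 k : 0 < layer_radius N r gamma k.
Proof. by rewrite mulr_gt0 ?exprn_gt0. Qed.

Lemma layer_radius_decr j k : (j < k <= N.+1)%N ->
  layer_radius N r gamma k < layer_radius N r gamma j.
Proof.
move=> /andP[jk kN]; rewrite ltr_pM2l// ltr_eXn2l//.
by rewrite ltn_sub2l// (leq_trans jk).
Qed.

Lemma ratio_pow_itv n : (0 < n)%N -> 0 < (gamma ^- 2) ^+ n < 1.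
Proof.
move=> n0; have h : 0 < gamma ^- 2 by rewrite invr_gt0 exprn_gt0.
by rewrite exprn_gt0//= exprn_ilt1 ?lt0n_neq0 ?(ltW h)// invf_lt1 ?exprn_gt0// exprn_egt1.
Qed.

Lemma is_GPT_vanishing sigma n : (0 < n)%N ->
  (forall j, (1 <= j <= N.+1)%N -> `|contrast sigma j| <= 1) ->
  is_GPT N (layer_radius N r gamma) (contrast sigma) n 0 <->
  (snum (contrasts N sigma)).[(gamma ^- 2) ^+ n] = 0.
Proof.
move=> n0 eta1.
pose rad := layer_radius N r gamma; pose w := (gamma ^- 2) ^+ n.
have w01 := ratio_pow_itv n0.
(* The system wants a geometric sequence over all indices, but [layer_radius] stays equal to [r]
   beyond [N.+1] by truncated subtraction. So [x] continues [rad k ^+ (2 n)] geometrically from its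
   value at index 0. *)
pose X := (r * gamma ^+ N.+1) ^+ n; pose x k := X * X * w ^+ k.
have xS k : x k.+1 = w * x k by rewrite /x exprS mulrCA.
have w0 : w != 0 by case/andP: w01 => /lt0r_neq0.
have X0 : X != 0 by rewrite lt0r_neq0// exprn_gt0// mulr_gt0// exprn_gt0.
have x0 k : x k != 0 by rewrite mulf_neq0 ?mulf_neq0 ?(expf_neq0 k w0).
have xE k : (k <= N.+1)%N -> x k = rad k ^+ n * rad k ^+ n.
  move=> kN; have gk : gamma ^+ k != 0 by rewrite expf_neq0// gt_eqF.
  have -> : rad k = r * gamma ^+ N.+1 / gamma ^+ k.
    by rewrite /rad /layer_radius -(subnK kN) exprD addnK mulrA mulfK.
  have wE : w ^+ k = (gamma ^+ k)^-1 ^+ n * (gamma ^+ k)^-1 ^+ n.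
    by rewrite /w !exprVn -invfM -!exprM -exprD; congr (_ ^- _); lia.
  by rewrite /x /X wE [in RHS]exprMn; ring.
have C0 : 2 * pi * n%:R != 0 :> R.
  by rewrite mulf_neq0 ?pnatr_eq0 -?lt0n// gt_eqF// twopi_gt0.
have Q0 : (sden (contrasts N sigma)).[w] != 0.
  rewrite gt_eqF//; apply: (schur_bound _ w01).1.
  by apply/allP/(all_nthP 0) => i; rewrite size_mkseq => iN; rewrite nth_mkseq// eta1.
have sys := @mode_systemE _ N rad (contrast sigma) n n0 layer_radius_gt0 _ x xE.
have mom phi : is_density N rad (contrast sigma) n phi ->
    (sden (contrasts N sigma)).[w] * moment N rad n phi =
    (snum (contrasts N sigma)).[w] * (2 * pi * n%:R * x 1%N).
  move=> h; rewrite (moment_density layer_radius_gt0 h).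
  apply: (layer_system_moment xS x0); apply/sys.
  exact: (density_mode_system n0 layer_radius_gt0 layer_radius_decr h).
split=> [[[phi h] /(_ phi h) m0]|P0].
  have := mom phi h; rewrite m0 mulr0 => /esym/eqP.
  by rewrite mulf_eq0 (negbTE (mulf_neq0 C0 (x0 1%N))) orbF => /eqP.
split=> [|phi h].
  have [b hb] := layer_system_solvable (2 * pi * n%:R) xS x0 w01 eta1.
  apply: (@mode_system_density _ N rad (contrast sigma) n n0 layer_radius_gt0
    layer_radius_decr
    (fun k => b k / rad k ^+ n.+1)).
  apply/sys; rewrite (_ : (fun k => _) = b)//.
  by apply/funext => k; rewrite mulrC divfK// expf_neq0// gt_eqF// layer_radius_gt0.
by apply: (mulfI Q0); rewrite mom// P0 mul0r mulr0.
Qed.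

End VanishingCriterion.

Theorem theorem6p1 (R : realType) (N : nat) (r gamma core : R)
    (hN : (1 <= N)%N) (hr : 0 < r) (hgamma : 1 < gamma) (hcore : 0 <= core) :
  (exists s : N.-tuple R, GPT_vanishing_coating r gamma core s) /\
  (core = 0 ->
    exists! s : N.-tuple R, GPT_vanishing_coating r gamma core s).
Proof.
pose z := [seq (gamma ^- 2) ^+ n | n <- iota 1 N].
have sz : size z = N by rewrite size_map size_iota.
have z01 : all (fun b => 0 < b < 1) z.
  by apply/allP => b /mapP[n]; rewrite mem_iota => /andP[n0 _] ->; exact: ratio_pow_itv.
have [q0 q1] : 0 < gamma ^- 2 /\ gamma ^- 2 < 1 :> R.
  by have /andP[] := ratio_pow_itv hgamma (ltn0Sn 0).
have uz : uniq z.
  rewrite map_inj_uniq ?iota_uniq// => m n /eqP h; apply/eqP; rewrite eqn_leq.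
  by rewrite -!(ler_iXn2l q0 q1) (eqP h) lexx.
have contrast1 (s : N.-tuple R) : admissible N (conductivity s core) ->
    forall j, (1 <= j <= N.+1)%N -> `|contrast (conductivity s core) j| <= 1.
  by move=> [s0 _] [//|j] /andP[_ jN]; apply: contrast_norm_le1; apply: s0 => //;
    exact: ltnW.
have crit (s : N.-tuple R) : GPT_vanishing_coating r gamma core s <->
    admissible N (conductivity s core) /\
    forall b, b \in z -> (snum (contrasts N (conductivity s core))).[b] = 0.
  split=> -[ad h].
    split=> // b /mapP[n]; rewrite mem_iota add1n ltnS => nN ->.
    have /andP[n0 _] := nN.
    by apply/(is_GPT_vanishing hr hgamma n0 (contrast1 s ad)); exact: h.
  split=> // n /andP[n0 nN].
  apply/(is_GPT_vanishing hr hgamma n0 (contrast1 s ad)); apply: h.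
  by apply/mapP; exists n => //; rewrite mem_iota add1n ltnS n0.
have [t [tpos t1 tz]] := coating_exists sz hN z01 hcore.
have tad : admissible N (conductivity t core).
  have t0 k : (k <= N.+1)%N -> 0 <= conductivity t core k.
    rewrite leq_eqVlt => /predU1P[->|]; first by rewrite conductivity_last.
    by rewrite ltnS => kN; rewrite ltW// tpos.
  split=> // -[//|k] /andP[_ kN].
  by rewrite gt_eqF//= ltr_pwDl ?tpos// t0.
have tvan : GPT_vanishing_coating r gamma core t by apply/crit.
split; first by exists t.
move=> core0; exists t; split=> // s /crit[sad sz0].
apply/esym; rewrite core0 in sad sz0 tad t1 tz.
exact: coating_unique sz uz sad tad t1 sz0 tz.
Qed.
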